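(* Let $K$ be a field and let $\mathbb{X}\subseteq\mathbb{P}^n_K$ be a $0$-dimensional locally Gorenstein scheme with no point of $\mathrm{Supp}(\mathbb{X})$ on the hyperplane $X_0=0$. Let $\sigma$ be a homogeneous trace map of degree zero of $Q^h(R)/L_0$, and let $\delta^\sigma_{\mathbb{X}}$ be the Dedekind different of $\mathbb{X}$ with respect to $\sigma$. Then $\mathbb{X}$ is a Cayley-Bacharach scheme if and only if, for all $p_j\in\mathrm{Supp}(\mathbb{X})$, every maximal $p_j$-subscheme $\mathbb{Y}\subseteq\mathbb{X}$ satisfies $$x_0^{r_{\mathbb{X}}-1}(I_{\mathbb{Y}/\mathbb{X}})_{r_{\mathbb{X}}}\nsubseteq(\delta^\sigma_{\mathbb{X}})_{2r_{\mathbb{X}}-1}.$$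
   Context: Setting. $P=K[X_0,\dots,X_n]$ has the standard grading, $I_{\mathbb{X}}\subseteq P$ is the (saturated) homogeneous vanishing ideal of $\mathbb{X}$, $R=P/I_{\mathbb{X}}$, and $\mathrm{Supp}(\mathbb{X})=\{p_1,\dots,p_s\}$ is the set of closed points. Since no $p_j$ lies on $X_0=0$, the residue class $x_0$ of $X_0$ in $R$ is a non-zerodivisor and $R$ is a $1$-dimensional Cohen-Macaulay ring. $\mathcal{O}_{\mathbb{X},p_j}$ is the local ring at $p_j$, with residue field $\kappa(p_j)$; $\varkappa_j=\dim_K\kappa(p_j)$; $\deg(\mathbb{X})=\sum_j\dim_K\mathcal{O}_{\mathbb{X},p_j}$. $\mathrm{HF}_{\mathbb{X}}(i)=\dim_K R_i$, and $r_{\mathbb{X}}$ is the least integer such that $\mathrm{HF}_{\mathbb{X}}(i)=\deg(\mathbb{X})$ for all $i\ge r_{\mathbb{X}}$. $\mathbb{X}$ is locally Gorenstein if every $\mathcal{O}_{\mathbb{X},p_j}$ is a Gorenstein ring. $Q^h(R)$ is the localization of $R$ at all homogeneous non-zerodivisors; $Q^h(R)=R_{x_0}\cong\prod_{j=1}^s\mathcal{O}_{\mathbb{X},p_j}[T_j,T_j^{-1}]$ with $\deg T_j=1$, via the injection $\tilde\imath:R\to Q^h(R)$, $\tilde\imath(f)=(f_{p_1}T_1^i,\dots,f_{p_s}T_s^i)$ for $f\in R_i$, where $f_{p_j}$ is the germ of $f$ at $p_j$ (the image of $f/x_0^i$ in $\mathcal{O}_{\mathbb{X},p_j}$). Maximal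 subschemes. A subscheme $\mathbb{Y}\subseteq\mathbb{X}$ is a $p_j$-subscheme if $\mathcal{O}_{\mathbb{Y},p_k}=\mathcal{O}_{\mathbb{X},p_k}$ for $k\ne j$ and $\mathcal{O}_{\mathbb{X},p_j}\to\mathcal{O}_{\mathbb{Y},p_j}$ is surjective; it is maximal if $\deg(\mathbb{Y})=\deg(\mathbb{X})-\varkappa_j$. Maximal $p_j$-subschemes correspond bijectively to the ideals $\langle s_j\rangle$ of $\mathcal{O}_{\mathbb{X},p_j}$ generated by a nonzero socle element $s_j$ (with $\mathcal{O}_{\mathbb{Y},p_j}=\mathcal{O}_{\mathbb{X},p_j}/\langle s_j\rangle$). $I_{\mathbb{Y}/\mathbb{X}}\subseteq R$ is the ideal of $\mathbb{Y}$ in $R$. For $a\in\mathcal{O}_{\mathbb{X},p_j}$ put $\mu(a)=\min\{i\in\mathbb{N}\mid(0,\dots,0,aT_j^i,0,\dots,0)\in\tilde\imath(R)\}$ (entry in position $j$). If $e_{j1},\dots,e_{j\varkappa_j}\in\mathcal{O}_{\mathbb{X},p_j}$ have residue classes forming a $K$-basis of $\kappa(p_j)$, put $\mu_{\mathbb{Y}/\mathbb{X}}=\max_k\mu(e_{jk}s_j)$ (independent of the choices). Cayley-Bacharach. $\deg_{\mathbb{X}}(p_j)$ is the minimum of $\mu_{\mathbb{Y}/\mathbb{X}}$ over all maximal $p_j$-subschemes $\mathbb{Y}$; one has $\deg_{\mathbb{X}}(p_j)\le r_{\mathbb{X}}$. $\mathbb{X}$ has the Cayley-Bacharach property of degree $d$,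 CBP($d$), if $\deg_{\mathbb{X}}(p_j)\ge d+1$ for all $j$; $\mathbb{X}$ is a Cayley-Bacharach scheme if it has CBP($r_{\mathbb{X}}-1$), i.e. $\deg_{\mathbb{X}}(p_j)=r_{\mathbb{X}}$ for all $j$. Dedekind different. $L_0=K[x_0,x_0^{-1}]$. A homogeneous trace map of degree zero of $Q^h(R)/L_0$ is a homogeneous element $\sigma$ of degree $0$ of the graded module $\underline{\mathrm{Hom}}_{L_0}(Q^h(R),L_0)$ with $\underline{\mathrm{Hom}}_{L_0}(Q^h(R),L_0)=Q^h(R)\cdot\sigma$, free with basis $\sigma$; it exists when $\mathbb{X}$ is locally Gorenstein. The Dedekind complementary module $\mathfrak{C}^\sigma_{\mathbb{X}}\subseteq Q^h(R)$ is the image of the injection $\underline{\mathrm{Hom}}_{K[x_0]}(R,K[x_0])\to\underline{\mathrm{Hom}}_{L_0}(Q^h(R),L_0)=Q^h(R)\sigma\cong Q^h(R)$, $\varphi\mapsto\varphi\otimes\mathrm{id}_{L_0}$ (the last isomorphism sending $g\sigma$ to $g$). The Dedekind different is $\delta^\sigma_{\mathbb{X}}=\{f\in Q^h(R)\mid f\cdot\mathfrak{C}^\sigma_{\mathbb{X}}\subseteq R\}$, a homogeneous ideal of $R$. *)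

(* Defs.v *)
From HB Require Import structures.
From mathcomp Require Import all_boot all_order all_algebra.
From mathcomp Require Import boolp.
From mathcomp Require Import mpoly.
From mathcomp Require Import ring.

Set Implicit Arguments.
Unset Strict Implicit.
Unset Printing Implicit Defensive.

Import GRing.Theory.
Local Open Scope ring_scope.
Local Open Scope quotient_scope.

(* Least natural number satisfying P, and 0 when there is none. *)
Definition natmin (P : nat -> Prop) : nat :=
  if pselect (exists i, `[< P i >]) is left h then ex_minn h else 0%N.

Section LinearAlgebra.
Variables (K : fieldType) (A : comNzRingType) (k : K -> A).

(* The residue classes of the b i form a K-basis of V / W, where K acts on A
   through k. *)
Definition quot_basis (V W : A -> Prop) (m : nat) (b : 'I_m -> A) : Prop :=
  [/\ forall i, V (b i),
      forall x, V x -> exists c : 'I_m -> K, W (x - \sum_i k (c i) * b i)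
    & forall c : 'I_m -> K,
        W (\sum_i k (c i) * b i) -> forall i, c i = 0].

(* dim_K (V / W), and 0 when V / W is infinite dimensional. *)
Definition quot_dim (V W : A -> Prop) : nat :=
  natmin (fun m => exists b : 'I_m -> A, quot_basis V W b).

End LinearAlgebra.

Definition full {A : Type} : A -> Prop := fun _ => True.
Definition zero {A : comNzRingType} : A -> Prop := fun x => x = 0.

Section CommutativeAlgebra.
Variable A : comNzRingType.

Definition is_ideal (J : A -> Prop) : Prop :=
  [/\ J 0, forall x y, J x -> J y -> J (x + y) & forall a x, J x -> J (a * x)].

Definition principal (s : A) : A -> Prop := fun x => exists a, x = a * s.

Definition noetherian : Prop :=
  forall J, is_ideal J -> exists (m : nat) (b : 'I_m -> A),
    forall x, J x <-> exists a : 'I_m -> A, x = \sum_i a i * b i.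

(* In a local ring this is the maximal ideal. *)
Definition nonunits : A -> Prop := fun x => ~ exists y, y * x = 1.

Definition is_local : Prop := is_ideal nonunits.

Definition injective_module (E : lmodType A) : Prop :=
  forall (M N : lmodType A) (f : {linear M -> N}) (g : {linear M -> E}),
    injective f -> exists h : {linear N -> E}, forall x, h (f x) = g x.

(* injdim_le d M: there is an exact sequence 0 -> M -> E0 -> ... -> Ed -> 0
   with all the Ei injective. *)
Inductive injdim_le : nat -> lmodType A -> Prop :=
| InjDim0 (d : nat) (M : lmodType A) : injective_module M -> injdim_le d M
| InjDimS (d : nat) (M E C : lmodType A)
    (f : {linear M -> E}) (g : {linear E -> C}) :
    injective_module E -> injective f ->
    (forall y, g y = 0 <-> exists x, y = f x) ->
    (forall z, exists y, g y = z) ->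
    injdim_le d C -> injdim_le d.+1 M.

Definition gorenstein_local : Prop :=
  [/\ noetherian, is_local & exists d, injdim_le d (A^o : lmodType A)].

End CommutativeAlgebra.

Section GradedRings.
(* gr d is the set of homogeneous elements of degree d. *)
Variables (A : comNzRingType) (gr : int -> A -> Prop).

Definition homog_ideal (J : A -> Prop) : Prop :=
  forall x, J x -> exists (N : nat) (f : nat -> A),
    (forall i, gr i%:Z (f i) /\ J (f i)) /\ x = \sum_(i < N) f i.

(* J contains every x such that (A_+)^k x is contained in J for some k. *)
Definition saturated (J : A -> Prop) : Prop :=
  forall (x : A) (k : nat),
    (forall g : 'I_k -> A,
       (forall i, exists2 d : int, 0 < d & gr d (g i)) ->
       J ((\prod_i g i) * x)) ->
    J x.

(* The points of Proj A. *)
Definition proj_point (p : prime_idealr A) : Prop :=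
  homog_ideal (fun x => x \in p) /\
  exists (d : int) (g : A), [/\ 0 < d, gr d g & g \notin p].

Definition closed_point (p : prime_idealr A) : Prop :=
  proj_point p /\
  forall q, proj_point q -> {subset p <= q} -> {subset q <= p}.

(* Proj A has Krull dimension 0; in particular it is not empty. *)
Definition proj_dim0 : Prop :=
  (exists p, proj_point p) /\
  forall p q, proj_point p -> proj_point q ->
    {subset p <= q} -> {subset q <= p}.

Definition enumerates_closed_points (s : nat) (p : 'I_s -> prime_idealr A)
    : Prop :=
  [/\ forall j, closed_point (p j),
      forall j k, p j =i p k -> j = k
    & forall q, closed_point q -> exists j, q =i p j].

(* Homomorphisms of B-modules from A to B, for a subring B of A. *)
Definition lin_to (B : A -> Prop) (phi : A -> A) : Prop :=
  [/\ forall x, B (phi x),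
      forall x y, phi (x + y) = phi x + phi y
    & forall b x, B b -> phi (b * x) = b * phi x].

Definition homog_map (d : int) (phi : A -> A) : Prop :=
  forall i x, gr i x -> gr (i + d) (phi x).

(* The graded module Hom_B(A, B), that is, the direct sum over the integers d
   of the B-linear maps that are homogeneous of degree d. *)
Definition graded_hom (B : A -> Prop) (phi : A -> A) : Prop :=
  exists (N : nat) (d : 'I_N -> int) (psi : 'I_N -> A -> A),
    (forall l, lin_to B (psi l) /\ homog_map (d l) (psi l)) /\
    forall x, phi x = \sum_l psi l x.

End GradedRings.

Section Localization.

Record multset (R : comNzRingType) := MultSet {
  ms_mem :> R -> bool;
  ms_one : ms_mem 1;
  ms_mul : forall x y, ms_mem x -> ms_mem y -> ms_mem (x * y);
  ms_nz : ~~ ms_mem 0 }.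

Variables (R : comNzRingType) (S : multset R).

Definition denom := {x : R | S x}.
Implicit Types (u v w : (R * denom)%type).

Definition loc_equiv u v : bool :=
  `[< exists2 t, S t & t * (u.1 * val v.2 - v.1 * val u.2) = 0 >].

Lemma loc_equiv_refl : reflexive loc_equiv.
Proof.
by move=> u; apply/asboolP; exists 1; [exact: ms_one | rewrite subrr mulr0].
Qed.

Lemma loc_equiv_sym : ssrbool.symmetric loc_equiv.
Proof.
by move=> u v; apply/asboolP/asboolP => -[t St e]; exists t => //;
   rewrite -opprB mulrN e oppr0.
Qed.

Lemma loc_equiv_trans : transitive loc_equiv.
Proof.
move=> v u w /asboolP[t St e] /asboolP[t' St' e']; apply/asboolP.
exists (t * t' * val v.2).
  by apply: ms_mul; [exact: ms_mul | exact: valP].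
have -> : t * t' * val v.2 * (u.1 * val w.2 - w.1 * val u.2) =
    t' * val w.2 * (t * (u.1 * val v.2 - v.1 * val u.2))
  + t * val u.2 * (t' * (v.1 * val w.2 - w.1 * val v.2)) by ring.
by rewrite e e' !mulr0 addr0.
Qed.

Canonical loc_equiv_rel :=
  EquivRel loc_equiv loc_equiv_refl loc_equiv_sym loc_equiv_trans.

Definition loc := {eq_quot loc_equiv}.

HB.instance Definition _ := Choice.on loc.
HB.instance Definition _ : EqQuotient _ loc_equiv loc := EqQuotient.on loc.

Definition mkfrac (f : R) (g : denom) : loc := \pi_loc (f, g).

Definition denom1 : denom := Sub 1 (ms_one S).
Definition denomM (g h : denom) : denom :=
  Sub (val g * val h) (ms_mul (valP g) (valP h)).

Lemma mkfracP f g f' g' :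
  mkfrac f g = mkfrac f' g' <->
  exists2 t, S t & t * (f * val g' - f' * val g) = 0.
Proof.
split=> [/eqquotP/asboolP //|h]; by apply/eqquotP/asboolP.
Qed.

Lemma locW (P : loc -> Prop) : (forall f g, P (mkfrac f g)) -> forall x, P x.
Proof. by move=> h; elim/quotW => -[f g]; exact: h. Qed.

Lemma mkfrac_eq f g f' g' :
  f * val g' = f' * val g -> mkfrac f g = mkfrac f' g'.
Proof.
by move=> e; apply/mkfracP; exists 1; [exact: ms_one | rewrite e subrr mulr0].
Qed.

Definition num (x : loc) : R := (repr x).1.
Definition den (x : loc) : denom := (repr x).2.

Lemma num_den x : mkfrac (num x) (den x) = x.
Proof. by rewrite /mkfrac /num /den -surjective_pairing reprK. Qed.

Definition loc_add (x y : loc) : loc :=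
  mkfrac (num x * val (den y) + num y * val (den x)) (denomM (den x) (den y)).
Definition loc_mul (x y : loc) : loc :=
  mkfrac (num x * num y) (denomM (den x) (den y)).
Definition loc_opp (x : loc) : loc := mkfrac (- num x) (den x).

Lemma loc_addE f g f' g' : loc_add (mkfrac f g) (mkfrac f' g') =
  mkfrac (f * val g' + f' * val g) (denomM g g').
Proof.
rewrite /loc_add; set x := mkfrac f g; set y := mkfrac f' g'.
have /mkfracP[t St e] : mkfrac (num x) (den x) = mkfrac f g by exact: num_den.
have /mkfracP[t' St' e'] : mkfrac (num y) (den y) = mkfrac f' g'
  by exact: num_den.
apply/mkfracP; exists (t * t'); first exact: ms_mul.
rewrite !SubK.
have -> : t * t' * ((num x * val (den y) + num y * val (den x)) *
    (val g * val g') - (f * val g' + f' * val g) *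
    (val (den x) * val (den y))) =
  t' * val (den y) * val g' * (t * (num x * val g - f * val (den x))) +
  t * val (den x) * val g * (t' * (num y * val g' - f' * val (den y)))
  by ring.
by rewrite e e' !mulr0 addr0.
Qed.

Lemma loc_mulE f g f' g' : loc_mul (mkfrac f g) (mkfrac f' g') =
  mkfrac (f * f') (denomM g g').
Proof.
rewrite /loc_mul; set x := mkfrac f g; set y := mkfrac f' g'.
have /mkfracP[t St e] : mkfrac (num x) (den x) = mkfrac f g by exact: num_den.
have /mkfracP[t' St' e'] : mkfrac (num y) (den y) = mkfrac f' g'
  by exact: num_den.
apply/mkfracP; exists (t * t'); first exact: ms_mul.
rewrite !SubK.
have -> : t * t' * (num x * num y * (val g * val g') -
    f * f' * (val (den x) * val (den y))) =
  t' * num y * val g' * (t * (num x * val g - f * val (den x))) +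
  t * f * val (den x) * (t' * (num y * val g' - f' * val (den y)))
  by ring.
by rewrite e e' !mulr0 addr0.
Qed.

Lemma loc_oppE f g : loc_opp (mkfrac f g) = mkfrac (- f) g.
Proof.
rewrite /loc_opp; set x := mkfrac f g.
have /mkfracP[t St e] : mkfrac (num x) (den x) = mkfrac f g by exact: num_den.
apply/mkfracP; exists t => //.
by rewrite !mulNr -opprD mulrN e oppr0.
Qed.

Lemma loc_addA : associative loc_add.
Proof.
elim/locW => f g; elim/locW => f' g'; elim/locW => f'' g''.
by rewrite !loc_addE; apply: mkfrac_eq; rewrite !SubK; ring.
Qed.

Lemma loc_addC : commutative loc_add.
Proof.
elim/locW => f g; elim/locW => f' g'.
by rewrite !loc_addE; apply: mkfrac_eq; rewrite !SubK; ring.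
Qed.

Lemma loc_add0 : left_id (mkfrac 0 denom1) loc_add.
Proof.
elim/locW => f g.
by rewrite !loc_addE; apply: mkfrac_eq; rewrite !SubK; ring.
Qed.

Lemma loc_addN : left_inverse (mkfrac 0 denom1) loc_opp loc_add.
Proof.
elim/locW => f g.
by rewrite loc_oppE !loc_addE; apply: mkfrac_eq; rewrite !SubK; ring.
Qed.

HB.instance Definition _ :=
  GRing.isZmodule.Build loc loc_addA loc_addC loc_add0 loc_addN.

Lemma loc_mulA : associative loc_mul.
Proof.
elim/locW => f g; elim/locW => f' g'; elim/locW => f'' g''.
by rewrite !loc_mulE; apply: mkfrac_eq; rewrite !SubK; ring.
Qed.

Lemma loc_mulC : commutative loc_mul.
Proof.
elim/locW => f g; elim/locW => f' g'.
by rewrite !loc_mulE; apply: mkfrac_eq; rewrite !SubK; ring.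
Qed.

Lemma loc_mul1 : left_id (mkfrac 1 denom1) loc_mul.
Proof.
elim/locW => f g.
by rewrite !loc_mulE; apply: mkfrac_eq; rewrite !SubK; ring.
Qed.

Lemma loc_mulD : left_distributive loc_mul loc_add.
Proof.
elim/locW => f g; elim/locW => f' g'; elim/locW => f'' g''.
rewrite !(loc_addE, loc_mulE); apply: mkfrac_eq; rewrite !SubK; ring.
Qed.

Lemma loc_nz : mkfrac 1 denom1 != 0.
Proof.
apply/eqP => /mkfracP[t St]; rewrite SubK !mulr1 subr0 mulr1 => t0.
by move: (ms_nz S); rewrite -t0 St.
Qed.

HB.instance Definition _ := GRing.Zmodule_isComNzRing.Build loc
  loc_mulA loc_mulC loc_mul1 loc_mulD loc_nz.

Definition loc_unit : {pred loc} := fun x => `[< exists y, y * x = 1 >].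
Definition loc_inv (x : loc) : loc :=
  if pselect (exists y, y * x = 1) is left h then projT1 (cid h) else x.

Lemma loc_mulV : {in loc_unit, left_inverse 1 loc_inv *%R}.
Proof.
move=> x /asboolP ux; rewrite /loc_inv; case: pselect => // h.
by case: cid.
Qed.

Lemma loc_unitP (x y : loc) : y * x = 1 -> x \in loc_unit.
Proof. by move=> e; apply/asboolP; exists y. Qed.

Lemma loc_inv_out : {in [predC loc_unit], loc_inv =1 id}.
Proof.
move=> x /asboolPn ux; rewrite /loc_inv; case: pselect => // h.
Qed.

HB.instance Definition _ := GRing.ComNzRing_hasMulInverse.Build loc
  loc_mulV loc_unitP loc_inv_out.

(* The fraction f / g, for g in S; junk 0 for g outside S. *)
Definition frac (f g : R) : loc :=
  if insub g is Some g' then mkfrac f g' else 0.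

Lemma fracE f g (Sg : S g) : frac f g = mkfrac f (Sub g Sg).
Proof. by rewrite /frac insubT. Qed.

Lemma fracM f g f' g' : S g -> S g' ->
  frac f g * frac f' g' = frac (f * f') (g * g').
Proof.
move=> Sg Sg'; rewrite !fracE; first exact: ms_mul.
move=> Sgg'; rewrite [LHS]loc_mulE.
by congr mkfrac; apply: val_inj; rewrite !SubK.
Qed.

Lemma fracB f g f' g' : S g -> S g' ->
  frac f g - frac f' g' = frac (f * g' - f' * g) (g * g').
Proof.
move=> Sg Sg'; rewrite !fracE; first exact: ms_mul.
move=> Sgg'; rewrite [- _]loc_oppE [LHS]loc_addE !SubK mulNr.
by congr mkfrac; apply: val_inj; rewrite !SubK.
Qed.

Lemma frac1 : frac 1 1 = 1.
Proof.
rewrite fracE; first exact: ms_one.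
by move=> h; congr mkfrac; apply: val_inj; rewrite !SubK.
Qed.

End Localization.

Section LocalizationGrading.
Variables (R : comNzRingType) (gr : int -> R -> Prop) (S : multset R).

(* f / g is homogeneous of degree deg f - deg g. *)
Definition loc_gr (d : int) (x : loc S) : Prop :=
  exists (i j : int) (f g : R),
    [/\ gr i f, gr j g, S g, d = i - j & x = frac S f g].

End LocalizationGrading.

(* I is the vanishing ideal of a subscheme X of P^n_K, and R = P / I is its
   homogeneous coordinate ring. *)
Section Scheme.
Variables (K : fieldType) (n : nat).
Local Notation P := {mpoly K[n.+1]}.

Definition poly_gr (d : int) (f : P) : Prop :=
  if d is Posz i then f \is i.-homog else f = 0.

Lemma poly_gr1 : poly_gr 0 1.
Proof. exact: dhomog1. Qed.

Lemma poly_gr0 i : poly_gr i 0.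
Proof. by case: i => //= i; exact: dhomog0. Qed.

Lemma poly_grM i j f g : poly_gr i f -> poly_gr j g -> poly_gr (i + j) (f * g).
Proof.
case: i => i; case: j => j; first exact: dhomogM.
- by move=> _ ->; rewrite mulr0; exact: poly_gr0.
- by move=> -> _; rewrite mul0r; exact: poly_gr0.
- by move=> -> _; rewrite mul0r; exact: poly_gr0.
Qed.

Lemma poly_grB i f g : poly_gr i f -> poly_gr i g -> poly_gr i (f - g).
Proof.
case: i => i /=; first exact: rpredB.
by move=> -> ->; rewrite subrr.
Qed.

Variable I : idealr P.
Local Notation R := {ideal_quot I}.

Definition coord_gr (d : int) (x : R) : Prop :=
  exists2 f, poly_gr d f & x = \pi_R f.

Lemma coord_gr1 : coord_gr 0 1.
Proof. by exists 1; [exact: poly_gr1 | rewrite rmorph1]. Qed.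

Lemma coord_grM i j x y :
  coord_gr i x -> coord_gr j y -> coord_gr (i + j) (x * y).
Proof.
move=> [f hf ->] [g hg ->]; exists (f * g); first exact: poly_grM.
by rewrite rmorphM.
Qed.

Lemma coord_grB i x y : coord_gr i x -> coord_gr i y -> coord_gr i (x - y).
Proof.
move=> [f hf ->] [g hg ->]; exists (f - g); first exact: poly_grB.
by rewrite rmorphB.
Qed.

Definition coord_const (c : K) : R := \pi_R (c%:MP).
Definition x0 : R := \pi_R 'X_ord0.

Definition homog_elt (x : R) : Prop := exists d, coord_gr d x.

Lemma homog_elt1 : homog_elt 1.
Proof. by exists 0; exact: coord_gr1. Qed.

Lemma homog_eltM x y : homog_elt x -> homog_elt y -> homog_elt (x * y).
Proof. by move=> [i hi] [j hj]; exists (i + j); exact: coord_grM. Qed.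

Definition is_nzd (x : R) : Prop := forall y, x * y = 0 -> y = 0.

Definition homog_nzd (x : R) : bool := `[< homog_elt x /\ is_nzd x >].

Lemma homog_nzd1 : homog_nzd 1.
Proof.
by apply/asboolP; split; [exact: homog_elt1 | move=> y; rewrite mul1r].
Qed.

Lemma homog_nzdM x y : homog_nzd x -> homog_nzd y -> homog_nzd (x * y).
Proof.
move=> /asboolP[hx nx] /asboolP[hy ny]; apply/asboolP.
by split; [exact: homog_eltM | move=> z; rewrite -mulrA => /nx/ny].
Qed.

Lemma homog_nzd_nz : ~~ homog_nzd 0.
Proof.
apply/asboolPn => -[_ /(_ 1)]; rewrite mul0r => /(_ erefl)/eqP.
by rewrite oner_eq0.
Qed.

Definition homog_nzds : multset R :=
  MultSet homog_nzd1 homog_nzdM homog_nzd_nz.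

(* The homogeneous ring of quotients Q^h(R). *)
Definition hquot := loc homog_nzds.
HB.instance Definition _ := GRing.ComUnitRing.on hquot.

Definition hquot_gr : int -> hquot -> Prop := loc_gr coord_gr (S := homog_nzds).
Definition to_hquot (f : R) : hquot := frac homog_nzds f 1.
Definition hquot_const (c : K) : hquot := to_hquot (coord_const c).

(* The subrings K[x_0] of R and L_0 = K[x_0, x_0^-1] of Q^h(R). *)
Definition Kx0 (x : R) : Prop :=
  exists h : {poly K}, x = (map_poly coord_const h).[x0].
Definition L0 (x : hquot) : Prop :=
  exists (h : {poly K}) (m : nat),
    x = (map_poly hquot_const h).[to_hquot x0] / to_hquot x0 ^+ m.

Section LocalRing.
Variable p : prime_idealr R.

Definition homog_compl (x : R) : bool := `[< homog_elt x >] && (x \notin p).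

Lemma homog_compl1 : homog_compl 1.
Proof.
by apply/andP; split; [apply/asboolP; exact: homog_elt1 | rewrite idealr1].
Qed.

Lemma homog_complM x y : homog_compl x -> homog_compl y -> homog_compl (x * y).
Proof.
move=> /andP[/asboolP hx nx] /andP[/asboolP hy ny]; apply/andP.
split; first by apply/asboolP; exact: homog_eltM.
by rewrite prime_idealrM negb_or nx.
Qed.

Lemma homog_compl_nz : ~~ homog_compl 0.
Proof. by rewrite /homog_compl idealr0 andbF. Qed.

Definition homog_compls : multset R :=
  MultSet homog_compl1 homog_complM homog_compl_nz.

Definition deg0_frac : {pred loc homog_compls} :=
  fun x => `[< loc_gr coord_gr 0 x >].

Lemma deg0_frac_subring : subring_closed deg0_frac.
Proof.
split=> [|x y|x y].
- apply/asboolP; exists 0, 0, 1, 1; split; try exact: coord_gr1.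
  + exact: homog_compl1.
  + by rewrite subrr.
  + by rewrite frac1.
- move=> /asboolP[i [i' [f [g [fi gi Sg /esym/eqP]]]]].
  rewrite subr_eq0 => /eqP e ->.
  move=> /asboolP[j [j' [f' [g' [fj gj Sg' /esym/eqP]]]]].
  rewrite subr_eq0 => /eqP e' ->; subst i' j'.
  rewrite fracB //; apply/asboolP.
  exists (i + j), (i + j), (f * g' - f' * g), (g * g'); split => //.
  + by apply: coord_grB; [|rewrite addrC]; exact: coord_grM.
  + exact: coord_grM.
  + exact: homog_complM.
  + by rewrite subrr.
- move=> /asboolP[i [i' [f [g [fi gi Sg /esym/eqP]]]]].
  rewrite subr_eq0 => /eqP e ->.
  move=> /asboolP[j [j' [f' [g' [fj gj Sg' /esym/eqP]]]]].
  rewrite subr_eq0 => /eqP e' ->; subst i' j'.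
  rewrite fracM //; apply/asboolP.
  exists (i + j), (i + j), (f * f'), (g * g'); split => //.
  + exact: coord_grM.
  + exact: coord_grM.
  + exact: homog_complM.
  + by rewrite subrr.
Qed.

HB.instance Definition _ := GRing.isSubringClosed.Build _ deg0_frac
  deg0_frac_subring.

(* The local ring of Proj R at p. *)
Record local_ring := LocalElt { local_val : loc homog_compls;
                                _ : local_val \in deg0_frac }.

HB.instance Definition _ := [isSub for local_val].
HB.instance Definition _ := [Choice of local_ring by <:].
HB.instance Definition _ := [SubChoice_isSubComNzRing of local_ring by <:].

(* The fraction f / g in the local ring at p, for f and g homogeneous of the
   same degree and g outside p; junk 0 otherwise. *)
Definition local_frac (f g : R) : local_ring :=
  insubd (0 : local_ring) (frac homog_compls f g).

Definition local_const (c : K) : local_ring := local_frac (coord_const c) 1.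

(* The germ at p of an element f of R_i. *)
Definition germ (i : nat) (f : R) : local_ring := local_frac f (x0 ^+ i).

Definition local_deg : nat := quot_dim local_const (@full local_ring) zero.

(* dim_K of the residue field at p. *)
Definition residue_deg : nat :=
  quot_dim local_const (@full local_ring) (@nonunits local_ring).

(* The kernel of the surjection from the local ring of X at p onto the local
   ring at p of the closed subscheme defined by the homogeneous ideal J. *)
Definition ideal_at (J : R -> Prop) (a : local_ring) : Prop :=
  exists (d : int) (f g : R),
    [/\ coord_gr d f, coord_gr d g, J f, g \notin p & a = local_frac f g].

Definition socle (a : local_ring) : Prop :=
  forall b, nonunits b -> b * a = 0.

End LocalRing.

Definition hilbert_function (i : int) : nat :=
  quot_dim coord_const (coord_gr i) zero.

(* A closed subscheme Y of X is given by its ideal I_{Y/X} in R. The unit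
   ideal, that is the empty Y, is allowed. *)
Definition is_subscheme (J : R -> Prop) : Prop :=
  [/\ is_ideal J, homog_ideal coord_gr J & saturated coord_gr J].

Section Points.
Variables (s : nat) (p : 'I_s -> prime_idealr R).

Definition degree : nat := (\sum_j local_deg (p j))%N.

Definition sub_degree (J : R -> Prop) : nat :=
  (\sum_j quot_dim (@local_const (p j)) full (@ideal_at (p j) J))%N.

Definition regularity_index (r : int) : Prop :=
  let regular r' := forall i, (r' <= i)%R -> hilbert_function i = degree in
  regular r /\ forall r', regular r' -> (r <= r')%R.

(* The surjectivity of the map of local rings at p j is automatic. *)
Definition point_subscheme (j : 'I_s) (J : R -> Prop) : Prop :=
  is_subscheme J /\
  forall k, k != j -> forall a, @ideal_at (p k) J a -> a = 0.

Definition maximal_subscheme (j : 'I_s) (J : R -> Prop) : Prop :=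
  point_subscheme j J /\ (sub_degree J + residue_deg (p j))%N = degree.

(* The image in the product of the local_ring (p j)[T_j, T_j^-1] of the map
   sending f in R_i to the family of the (germ of f at p j) T_j^i. As i is
   nonnegative, it lies in the product of the polynomial rings. *)
Definition germs_image (v : forall j, {poly local_ring (p j)}) : Prop :=
  exists (N : nat) (f : nat -> R),
    (forall i, coord_gr i%:Z (f i)) /\
    forall j, v j = \sum_(i < N) germ (p j) i (f i) *: 'X^i.

Definition mu (j : 'I_s) (a : local_ring (p j)) : nat :=
  natmin (fun i => exists v, [/\ germs_image v, v j = a *: 'X^i
                              & forall k, k != j -> v k = 0]).

(* m is the value of mu_{Y/X} for some generator t of the ideal of Y at p j
   and some elements e of the local ring lifting a K-basis of the residue
   field. *)
Definition is_mu_sub (j : 'I_s) (J : R -> Prop) (m : nat) : Prop :=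
  exists (t : local_ring (p j)) (N : nat) (e : 'I_N -> local_ring (p j)),
    [/\ t <> 0 /\ socle t,
        forall a, ideal_at J a <-> principal t a,
        quot_basis (@local_const (p j)) full (@nonunits (local_ring (p j))) e
      & m = \max_k mu (e k * t)%R].

Definition point_degree (j : 'I_s) : nat :=
  natmin (fun m => exists2 J, maximal_subscheme j J & is_mu_sub j J m).

Definition CBP (d : int) : Prop :=
  forall j, (d + 1 <= (point_degree j)%:Z)%R.

Definition cayley_bacharach (r : int) : Prop := CBP (r - 1).

End Points.

(* A homogeneous trace map of degree zero of Q^h(R) / L_0. *)
Definition trace_map (sigma : hquot -> hquot) : Prop :=
  [/\ graded_hom hquot_gr L0 sigma, homog_map hquot_gr 0 sigma
    & forall phi, graded_hom hquot_gr L0 phi ->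
        exists! g, forall x, phi x = sigma (g * x)].

(* g belongs to the complementary module when g sigma : x |-> sigma (g * x) is
   phi (x) id_{L_0} for some phi. Here f (x) l in R (x)_{K[x_0]} L_0 is
   identified with the product f * l in Q^h(R). *)
Definition dedekind_complementary (sigma : hquot -> hquot) (g : hquot) : Prop :=
  exists phi : R -> R, graded_hom coord_gr Kx0 phi /\
    forall f l, L0 l ->
      sigma (g * (to_hquot f * l)) = to_hquot (phi f) * l.

Definition dedekind_different (sigma : hquot -> hquot) (f : hquot) : Prop :=
  forall g, dedekind_complementary sigma g -> exists h, f * g = to_hquot h.

End Scheme.

(* Main.v *)
(* Write V_i for the subspace x0^(-i) R_i of the ring A of elements of degree 0
   of Q^h(R), and W for the orthogonal of V_(r-1) under the nondegenerate form
   (a, b) |-> sigma (a b) on A. In degree -r the complementary module is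
   x0^(-r) W, and V_i = A for i >= r, so x0^(r-1) I_{Y/X} lies in the different
   in degree 2r-1 exactly when N W is contained in V_(r-1), where N is the
   minimal ideal of A that corresponds to Y. On the other hand the
   Cayley-Bacharach property says that no such N is contained in V_(r-1). Now
   N W is contained in V_(r-1) if and only if N is. If N W <= N <= V_(r-1) this
   is clear. If N is not contained in V_(r-1), some f in N and w in W satisfy
   sigma (w f) <> 0; then w N = N by minimality, so N W is not contained in
   V_(r-1) either. *)

Require Import Defs.
From HB Require Import structures.
From mathcomp Require Import all_boot all_order all_algebra.
From mathcomp Require Import boolp.
From mathcomp Require classical_sets.
From mathcomp Require Import mpoly.
From mathcomp Require Import ring zify.

Set Implicit Arguments.
Unset Strict Implicit.
Unset Printing Implicit Defensive.

Import GRing.Theory.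
Local Open Scope ring_scope.
Local Open Scope quotient_scope.

(** * Finite-dimensional quotients *)

(** The ring A and its decomposition into local rings are never built: an element of A is handled as
    a form of degree [r] together with its germs. Everything rests on two facts: [x0] is a
    non-zerodivisor, and R_(d+r) = x0^d R_r. The first comes from saturation, because a homogeneous
    ideal contained in no [p k] contains all forms of large degree; the second then follows by
    counting dimensions. An element g of the complementary module need not have degree -r. Its
    components of degree below -r vanish, since [sigma] maps g R_r into R, which has nothing in
    negative degrees. Its components of degree above -r are harmless: multiplied by x0^(r-1) f they
    land in degree at least r, where R and Q^h(R) agree. So degree -r decides, and this explains the
    exponent r - 1. Both sides of the theorem are compared with [divisible_at_r], the inclusion of
    J_r in x0 R. It also makes sense for r = 0, where x0^(r-1) has a negative exponent and V_(-1) is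
    0. *)

Lemma natmin_spec (P : nat -> Prop) i : P i -> P (natmin P) /\ (natmin P <= i)%N.
Proof.
move=> Pi; rewrite /natmin; case: pselect => [h|[]]; last first.
  by exists i; apply/asboolP.
by case: ex_minnP => m /asboolP Pm mmin; split=> //; apply/mmin/asboolP.
Qed.

Lemma natmin_lb (P : nat -> Prop) i m :
  P i -> (forall l, P l -> (m <= l)%N) -> (m <= natmin P)%N.
Proof. by move=> /natmin_spec[Pm _]; apply. Qed.

Section LinearAlgebra.
Variables (K : fieldType) (A : comNzRingType) (k : {rmorphism K -> A}).
Implicit Types (V W : A -> Prop).

Definition is_subspace V : Prop :=
  V 0 /\ forall c x y, V x -> V y -> V (k c * x + y).

Lemma zero_subspace : is_subspace (@zero A).
Proof. by split=> // c x y -> ->; rewrite /zero mulr0 addr0. Qed.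

Lemma subspaceD V x y : is_subspace V -> V x -> V y -> V (x + y).
Proof. by case=> _ h Vx Vy; rewrite -[x]mul1r -(rmorph1 k); exact: h. Qed.

Lemma subspaceZ V c x : is_subspace V -> V x -> V (k c * x).
Proof. by case=> V0 h Vx; rewrite -[_ * _]addr0; exact: h. Qed.

Lemma subspaceB V x y : is_subspace V -> V x -> V y -> V (x - y).
Proof.
move=> hV Vx Vy; apply: subspaceD => //.
by rewrite -mulN1r -(rmorph1 k) -rmorphN; apply: subspaceZ.
Qed.

Lemma subspace_sum V (T : Type) (s : seq T) (P : pred T) (F : T -> A) :
  is_subspace V -> (forall i, P i -> V (F i)) -> V (\sum_(i <- s | P i) F i).
Proof.
move=> hV VF; elim/big_rec: _ => [|i x Pi Vx]; first by case: hV.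
by apply: subspaceD => //; exact: VF.
Qed.

Lemma subspace_lin V m (b : 'I_m -> A) (c : 'I_m -> K) :
  is_subspace V -> (forall i, V (b i)) -> V (\sum_i k (c i) * b i).
Proof. by move=> hV Vb; apply: subspace_sum => // i _; exact: subspaceZ. Qed.

(** Independence of [v] makes the matrix of its coordinates in [b] row free, which bounds [N]; when
    [N = m] this matrix is invertible, so [v] also spans. The second half is how surjectivity of a
    multiplication map is later drawn from its injectivity. *)
Lemma quot_basis_indep V W m (b : 'I_m -> A) N (v : 'I_N -> A) :
  is_subspace W -> quot_basis k V W b ->
  (forall i, V (v i)) ->
  (forall c : 'I_N -> K, W (\sum_i k (c i) * v i) -> forall i, c i = 0) ->
  (N <= m)%N /\ (N = m -> quot_basis k V W v).
Proof.
move=> hW [Vb bspan bfree] Vv vfree.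
have [C hC] := choice (fun i => bspan _ (Vv i)).
pose M := \matrix_(i < N, j < m) C i j.
have comb (c : 'rV_N) :
    W (\sum_i k (c 0 i) * v i - \sum_j k ((c *m M) 0 j) * b j).
  have -> : \sum_j k ((c *m M) 0 j) * b j =
      \sum_i k (c 0 i) * \sum_j k (C i j) * b j.
    under [RHS]eq_bigr do rewrite mulr_sumr.
    rewrite exchange_big; apply: eq_bigr => j _.
    rewrite mxE rmorph_sum mulr_suml; apply: eq_bigr => i _.
    by rewrite mxE rmorphM mulrA.
  rewrite -sumrB; apply: subspace_sum => // i _.
  by rewrite -mulrBr; apply: subspaceZ.
have Mfree : row_free M.
  apply: inj_row_free => c cM0; apply/rowP => i; rewrite mxE.
  apply: (vfree (c 0)); have := comb c; rewrite cM0.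
  by under [X in _ - X]eq_bigr do rewrite mxE rmorph0 mul0r; rewrite big1_eq subr0.
split=> [|Nm]; first by move: Mfree; rewrite /row_free => /eqP <-; exact: rank_leq_col.
subst m; split=> // x /bspan[d hd].
pose e := (\row_j d j) *m invmx M.
exists (e 0); rewrite -[x](subrK (\sum_j k (d j) * b j)) -addrA.
apply: subspaceD => //; have := comb e.
rewrite mulmxKV -?row_free_unit //.
under [X in _ - X]eq_bigr do rewrite mxE.
by move=> /(subspaceB hW (proj1 hW)); rewrite sub0r opprB.
Qed.

Lemma quot_basis_exists V W N (v : 'I_N -> A) :
  is_subspace W -> (forall i, V (v i)) ->
  (forall x, V x -> exists c : 'I_N -> K, W (x - \sum_i k (c i) * v i)) ->
  exists (m : nat) (b : 'I_m -> A), quot_basis k V W b.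
Proof.
move=> hW; elim: N v => [|N IH] v Vv vspan.
  by exists 0%N, v; split=> // c _ i; have := ltn_ord i.
have [vfree|] := pselect (forall c : 'I_N.+1 -> K,
    W (\sum_i k (c i) * v i) -> forall i, c i = 0).
  by exists N.+1, v.
move=> /existsNP[c] /not_implyP[Wc] /existsNP[i0 /eqP ci0].
apply: (IH (v \o lift i0)) => [i|x /vspan[d Wd]]; first exact: Vv.
(* These are the coefficients of [x] after eliminating [v i0] by means of the relation [c]. *)
exists (fun i => d (lift i0 i) - d i0 / c i0 * c (lift i0 i)).
have := subspaceD hW Wd (subspaceZ (d i0 / c i0) hW Wc).
rewrite !(bigD1_ord i0) //= mulrDr mulrA -rmorphM mulfVK //.
rewrite mulr_sumr.
have -> : \sum_(i < N) k (d (lift i0 i) - d i0 / c i0 * c (lift i0 i)) * v (lift i0 i)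
   = \sum_(i < N) k (d (lift i0 i)) * v (lift i0 i)
     - \sum_(i < N) k (d i0 / c i0) * (k (c (lift i0 i)) * v (lift i0 i)).
  rewrite -sumrB; apply: eq_bigr => i _.
  by rewrite rmorphB (rmorphM k (_ / _)) mulrBl -mulrA.
set X := k (d i0) * v i0; set Y := \sum_(i < N) k (d _) * _.
set Z := \sum_(i < N) _; suff -> : x - (X + Y) + (X + Z) = x - (Y - Z) by [].
ring.
Qed.

Lemma quot_basis_dim V W m (b : 'I_m -> A) :
  is_subspace W -> quot_basis k V W b -> quot_dim k V W = m.
Proof.
move=> hW hb.
have [|[b' hb'] le_m] :=
    @natmin_spec (fun m => exists b : 'I_m -> A, quot_basis k V W b) m.
  by exists b.
apply/eqP; rewrite eqn_leq le_m /=.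
case: hb => Vb _ bfree.
by have [] := quot_basis_indep hW hb' Vb bfree.
Qed.

(** As a least number with default 0, [quot_dim] is the size of a basis only once some finite basis
    is known. *)
Lemma quot_basis_of_dim V W m (b : 'I_m -> A) :
  quot_basis k V W b -> exists b' : 'I_(quot_dim k V W) -> A, quot_basis k V W b'.
Proof.
move=> hb.
by have [|//] :=
    @natmin_spec (fun m => exists b : 'I_m -> A, quot_basis k V W b) m;
  exists b.
Qed.

Lemma quot_dim_eq V V' W W' :
  (forall x, V x <-> V' x) -> (forall x, W x <-> W' x) ->
  quot_dim k V W = quot_dim k V' W'.
Proof.
move=> eV eW; have -> : V = V' by apply/funext => x; apply/propext.
by have -> : W = W' by apply/funext => x; apply/propext.
Qed.

(** A basis of [V] modulo the larger [W'] is independent modulo [W], so by the equal count it spans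
    [V] modulo [W]; an element of [W'] then has only zero coordinates. *)
Lemma quot_basis_sub_eq V W W' m (b b' : 'I_m -> A) :
  is_subspace V -> is_subspace W -> is_subspace W' ->
  quot_basis k V W b -> quot_basis k V W' b' ->
  (forall x, W x -> W' x) -> forall x, V x -> W' x -> W x.
Proof.
move=> hV hW hW' hb [Vb' _ b'free] WW' x Vx W'x.
have [_ /(_ erefl)[_ b'span _]] := quot_basis_indep hW hb Vb'
  (fun c Wc => b'free c (WW' _ Wc)).
have [c Wc] := b'span x Vx.
have c0 : forall i, c i = 0.
  apply: b'free; have := subspaceB hW' W'x (WW' _ Wc).
  by rewrite opprB addrC subrK.
by move: Wc; under eq_bigr do rewrite c0 rmorph0 mul0r; rewrite big1_eq subr0.
Qed.

(** The functional is a coordinate in the basis [b] that does not vanish at [f]. Coordinates are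
    arbitrary outside [V], hence the guards in the conclusion. *)
Lemma quot_basis_functional V W m (b : 'I_m -> A) f :
  is_subspace V -> is_subspace W -> quot_basis k V W b -> V f -> ~ W f ->
  exists l : A -> K,
    [/\ forall c x y, V x -> V y -> l (k c * x + y) = c * l x + l y,
        forall x, V x -> W x -> l x = 0 & l f <> 0].
Proof.
move=> hV hW [Vb bspan bfree] Vf Wf.
have /choice[C hC] x : exists c : 'I_m -> K,
    V x -> W (x - \sum_i k (c i) * b i).
  have [/bspan[c hc]|nV] := pselect (V x); first by exists c.
  by exists (fun _ => 0).
have Cuniq x c : V x -> W (x - \sum_i k (c i) * b i) -> forall i, C x i = c i.
  move=> Vx hc i; apply/eqP; rewrite -subr_eq0; apply/eqP.
  apply: (bfree (fun i => C x i - c i)).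
  have := subspaceB hW hc (hC x Vx).
  have -> // : (x - \sum_i k (c i) * b i) - (x - \sum_i k (C x i) * b i) =
      \sum_i k (C x i - c i) * b i.
  have -> : \sum_i k (C x i - c i) * b i =
      \sum_i k (C x i) * b i - \sum_i k (c i) * b i.
    by rewrite -sumrB; apply: eq_bigr => j _; rewrite rmorphB mulrBl.
  by ring.
have [i Ci] : exists i, C f i <> 0.
  apply/existsNP => Cf0; apply: Wf; have := hC f Vf.
  by under eq_bigr do rewrite Cf0 rmorph0 mul0r; rewrite big1_eq subr0.
exists (fun x => C x i); split=> // [c x y Vx Vy|x Vx Wx].
- apply: (Cuniq _ (fun i => c * C x i + C y i)); first exact: (proj2 hV).
  have := proj2 hW c _ _ (hC x Vx) (hC y Vy).
  have -> // : k c * (x - \sum_i k (C x i) * b i) + (y - \sum_i k (C y i) * b i) =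
    k c * x + y - \sum_i k (c * C x i + C y i) * b i.
  rewrite (_ : \sum_i k (c * C x i + C y i) * b i =
     k c * (\sum_i k (C x i) * b i) + \sum_i k (C y i) * b i); first by ring.
  rewrite mulr_sumr -big_split; apply: eq_bigr => j _ /=.
  by rewrite rmorphD rmorphM mulrDl mulrA.
- apply: (Cuniq x (fun=> 0)) => //.
  by under eq_bigr do rewrite rmorph0 mul0r; rewrite big1_eq subr0.
Qed.

End LinearAlgebra.

(** * The grading of the coordinate ring *)

Lemma zero_ideal (A : comNzRingType) : is_ideal (fun x : A => x = 0).
Proof.
by split=> // [x y -> ->|a x ->]; rewrite ?addr0 ?mulr0.
Qed.

Lemma ideal_sum (A : comNzRingType) (L : A -> Prop) (T : Type) (s : seq T)
    (Q : pred T) (F : T -> A) :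
  is_ideal L -> (forall t, Q t -> L (F t)) -> L (\sum_(t <- s | Q t) F t).
Proof. by move=> [L0 LD _] h; apply: big_ind. Qed.

Lemma principal_ideal (A : comNzRingType) (t : A) : is_ideal (principal t).
Proof.
split=> [|x y [a ->] [b ->]|a x [b ->]]; first by exists 0; rewrite mul0r.
- by exists (a + b); rewrite mulrDl.
- by exists (a * b); rewrite mulrA.
Qed.

Lemma prime_expn (A : comNzRingType) (q : prime_idealr A) x N : x \notin q -> x ^+ N \notin q.
Proof.
move=> xq; elim: N => [|N IH]; first by rewrite idealr1.
by rewrite exprS prime_idealrM negb_or xq.
Qed.

Section Graded.
Variables (K : fieldType) (n : nat) (I : idealr {mpoly K[n.+1]}).
Local Notation P := {mpoly K[n.+1]}.
Local Notation R := {ideal_quot I}.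
Local Notation gr := (@coord_gr K n I).

Lemma coord_const_zmod : zmod_morphism (@coord_const K n I).
Proof. by move=> x y; rewrite /coord_const mpolyCB rmorphB. Qed.

Lemma coord_const_monoid : monoid_morphism (@coord_const K n I).
Proof.
split; first by rewrite /coord_const mpolyC1 rmorph1.
by move=> x y; rewrite /coord_const mpolyCM rmorphM.
Qed.

HB.instance Definition _ :=
  GRing.isZmodMorphism.Build K R (@coord_const K n I) coord_const_zmod.
HB.instance Definition _ :=
  GRing.isMonoidMorphism.Build K R (@coord_const K n I) coord_const_monoid.

Lemma coord_piP (x : R) : exists f : P, x = \pi_R f.
Proof. by exists (repr x); rewrite reprK. Qed.

Lemma pi_eq0 (f : P) : (\pi_R f = 0) <-> f \in I.
Proof.
rewrite -[X in _ <-> is_true (X \in _)]subr0 Quotient.idealrBE.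
by rewrite -(rmorph0 \pi_R); split=> [->|/eqP].
Qed.

Lemma coord_gr0 d : gr d 0.
Proof. by exists 0; [exact: poly_gr0 | rewrite rmorph0]. Qed.

Lemma coord_grN i x : gr i x -> gr i (- x).
Proof. by move=> h; rewrite -sub0r; apply: coord_grB => //; exact: coord_gr0. Qed.

Lemma coord_grD i x y : gr i x -> gr i y -> gr i (x + y).
Proof. by move=> hx hy; rewrite -[y]opprK; apply: coord_grB => //; exact: coord_grN. Qed.

Lemma coord_gr_const c : gr 0 (coord_const I c).
Proof.
exists (c%:MP) => //=; rewrite -[c%:MP]mulr1 mul_mpolyC.
exact/dhomogZ/dhomog1.
Qed.

Lemma coord_grZ c i f : gr i f -> gr i (coord_const I c * f).
Proof. by move=> hf; rewrite -[i]add0r; apply: coord_grM => //; exact: coord_gr_const. Qed.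

Lemma coord_gr_neg (m : nat) x : gr (Negz m) x -> x = 0.
Proof. by move=> [f /= -> ->]; rewrite rmorph0. Qed.

Lemma coord_gr_subspace d : is_subspace (@coord_const K n I) (gr d).
Proof.
split=> [|c x y hx hy]; first exact: coord_gr0.
by apply: coord_grD => //; rewrite -[d]add0r; exact: coord_grM (coord_gr_const c) hx.
Qed.

Lemma coord_gr_var i : gr 1 (\pi_R 'X_i).
Proof. by exists ('X_i) => //=; rewrite dhomogX; apply/eqP; exact: mdeg1. Qed.

Lemma coord_gr_x0 : gr 1 (x0 I).
Proof. exact: coord_gr_var. Qed.

Lemma coord_grX (d : nat) (g : R) k : gr d%:Z g -> gr (d * k)%N%:Z (g ^+ k).
Proof.
move=> hg; elim: k => [|k IH]; first by rewrite muln0; exact: coord_gr1.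
by rewrite exprS mulnS PoszD; exact: coord_grM.
Qed.

Lemma coord_gr_x0X k : gr k%:Z (x0 I ^+ k).
Proof. by have := coord_grX k coord_gr_x0; rewrite mul1n. Qed.

Lemma coord_gr_basis (d : nat) (W : R -> Prop) : is_subspace (@coord_const K n I) W ->
  exists (m : nat) (b : 'I_m -> R), quot_basis (@coord_const K n I) (gr d%:Z) W b.
Proof.
move=> hW; pose T := [the finType of 'X_{1..n.+1 < d.+1}].
(* Monomials of degree less than [d] are replaced by 0, which does no harm to a spanning family. *)
pose w (t : T) : R := if mdeg t == d then \pi_R 'X_[t] else 0.
apply: (@quot_basis_exists _ _ _ _ _ #|T| (fun i => w (enum_val i))) => // [i|x].
  rewrite /w; case: eqP => [hd|_]; last exact: coord_gr0.
  by exists ('X_[enum_val i]); rewrite //= dhomogX; apply/eqP.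
case=> f hf ->; exists (fun i : 'I_#|T| => f@_(enum_val i : T)).
suff -> : \pi_R f = \sum_(i < #|T|) coord_const I f@_(enum_val i : T) * w (enum_val i).
  by rewrite subrr; case: hW.
rewrite -(big_enum_val (A := T) (fun t : T => coord_const I f@_t * w t)) /=.
have fd : (msize f <= d.+1)%N.
  rewrite msizeE; apply/bigmax_leqP_seq => m mf _.
  by have /dhomogP/(_ m mf) /= -> := hf.
rewrite {1}(mpolywE fd) rmorph_sum /=.
apply: eq_bigr => t _; rewrite -mul_mpolyC rmorphM /= /w.
case: eqP => // hd.
rewrite (dhomog_nemf_coeff hf); last exact/eqP.
by rewrite mpolyC0 rmorph0 mul0r rmorph0 mul0r.
Qed.

Hypothesis I_homog : homog_ideal (@poly_gr K n) (fun f => f \in I).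

Lemma pihomog_ideal d (f : P) : f \in I -> pihomog mdeg d f \in I.
Proof.
move=> /I_homog[N [g [hg ->]]]; rewrite raddf_sum /=; apply: rpred_sum => i _.
have [hi gi] := hg i; have [->|ne] := eqVneq (i : nat) d.
  by have [hd gd] := hg d; rewrite pihomog_dE.
by rewrite (pihomog_ne0 ne hi) idealr0.
Qed.

Definition homog_part (d : nat) (x : R) : R := \pi_R (pihomog mdeg d (repr x)).

(** Homogeneity of [I] makes the part independent of the representative used in [homog_part]. *)
Lemma homog_part_pi d f : homog_part d (\pi_R f) = \pi_R (pihomog mdeg d f).
Proof.
apply/eqP; rewrite -subr_eq0 -rmorphB -raddfB /=; apply/eqP/pi_eq0/pihomog_ideal.
by rewrite Quotient.idealrBE reprK.
Qed.

Lemma homog_part_zmod d : zmod_morphism (homog_part d).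
Proof.
move=> x y; have [f ->] := coord_piP x; have [g ->] := coord_piP y.
by rewrite -rmorphB !homog_part_pi raddfB rmorphB.
Qed.

Lemma homog_partB d x y : homog_part d (x - y) = homog_part d x - homog_part d y.
Proof. exact: homog_part_zmod. Qed.

Lemma homog_part0 d : homog_part d 0 = 0.
Proof. by have := homog_partB d 0 0; rewrite !subrr. Qed.

Lemma homog_partD d x y : homog_part d (x + y) = homog_part d x + homog_part d y.
Proof. by have := homog_partB d (x + y) y; rewrite addrK => ->; rewrite subrK. Qed.

Lemma homog_part_sum d (T : Type) (s : seq T) (Q : pred T) (F : T -> R) :
  homog_part d (\sum_(t <- s | Q t) F t) = \sum_(t <- s | Q t) homog_part d (F t).
Proof.
elim/big_rec2: _ => [|t y x _ <-]; first exact: homog_part0.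
exact: homog_partD.
Qed.

Lemma homog_part_gr (d : nat) x : gr d%:Z (homog_part d x).
Proof. by exists (pihomog mdeg d (repr x)) => //; exact: pihomogP. Qed.

Lemma homog_part_id (d : nat) x : gr d%:Z x -> homog_part d x = x.
Proof. by move=> [f hf ->]; rewrite homog_part_pi pihomog_dE. Qed.

Lemma homog_part_ne (d e : nat) x : gr e%:Z x -> e <> d -> homog_part d x = 0.
Proof.
by move=> [f hf ->] /eqP ne; rewrite homog_part_pi (pihomog_ne0 ne hf) rmorph0.
Qed.

Lemma homog_part_decomp x : exists N, forall M, (N <= M)%N -> x = \sum_(i < M) homog_part i x.
Proof.
have [f ->] := coord_piP x; exists (msize f) => M hM.
under eq_bigr do rewrite homog_part_pi.
by rewrite -rmorph_sum -pihomog_partitionE.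
Qed.

Lemma homog_part_mul_lt (d e : nat) g x : gr e%:Z g -> (d < e)%N -> homog_part d (g * x) = 0.
Proof.
move=> hg de; have [N /(_ N (leqnn N)) ->] := homog_part_decomp x.
rewrite mulr_sumr homog_part_sum big1 // => i _.
apply: (@homog_part_ne _ (e + i)%N); last lia.
by rewrite PoszD; exact: coord_grM (homog_part_gr _ _).
Qed.

Lemma homog_part_mul (d e : nat) g x : gr e%:Z g ->
  homog_part (e + d) (g * x) = g * homog_part d x.
Proof.
move=> hg; have [N hN] := homog_part_decomp x.
have dM : (d < maxn N d.+1)%N by lia.
rewrite [in LHS](hN (maxn N d.+1)) ?leq_maxl //.
rewrite mulr_sumr homog_part_sum (bigD1 (Ordinal dM)) //= big1 ?addr0.
  by apply: homog_part_id; rewrite PoszD; exact: coord_grM (homog_part_gr _ _).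
move=> i ne; apply: (@homog_part_ne _ (e + i)%N).
  by rewrite PoszD; exact: coord_grM (homog_part_gr _ _).
by move=> /addnI h; case/eqP: ne; apply: val_inj.
Qed.

Lemma homog_idealP (L : R -> Prop) : is_ideal L ->
  homog_ideal gr L <-> forall d x, L x -> L (homog_part d x).
Proof.
move=> [L0 LD LM]; split=> [hL d x /hL[N [f [hf ->]]]|hL x Lx].
  rewrite homog_part_sum; apply: big_ind => // i _.
  have [hi fi] := hf i; have [<-|ne] := eqVneq (i : nat) d; first by rewrite homog_part_id.
  by rewrite (homog_part_ne hi) //; exact/eqP.
have [N hN] := homog_part_decomp x; exists N, (fun i => homog_part i x); split.
  by move=> i; split; [exact: homog_part_gr | exact: hL].
exact: hN.
Qed.

Lemma ideal_homog_partP (L : R -> Prop) x : is_ideal L ->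
  (forall d, L (homog_part d x)) -> L x.
Proof.
move=> hL h; have [N /(_ N (leqnn N)) ->] := homog_part_decomp x.
exact: ideal_sum.
Qed.

(** A product of [N] homogeneous elements of positive degree has degree at least [N]. *)
Lemma saturated_mem (J : R -> Prop) N x : saturated gr J -> is_ideal J ->
  (forall (d : nat) f, (N <= d)%N -> gr d%:Z f -> J (f * x)) -> J x.
Proof.
move=> hJ idJ h; apply: (hJ x N) => g hg.
suff [d Nd gd] : exists2 d : nat, (N <= d)%N & gr d%:Z (\prod_i g i) by exact: h gd.
elim: N g hg {h} => [|N IH] g hg; first by exists 0%N; rewrite // big_ord0; exact: coord_gr1.
have [d dN gd] := IH (g \o lift ord0) (fun i => hg _).
rewrite big_ord_recl; have [[e|//] e0 ge] := hg ord0.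
exists (e + d)%N; first by lia.
by rewrite PoszD; exact: coord_grM.
Qed.

Hypothesis I_saturated : saturated (@poly_gr K n) (fun f => f \in I).

Lemma zero_saturated : saturated gr (fun x : R => x = 0).
Proof.
move=> x k; have [f ->] := coord_piP x => h.
apply/pi_eq0/(I_saturated (k := k)) => g hg; apply/pi_eq0.
rewrite rmorphM rmorph_prod; apply: h => i.
by have [d d0 gd] := hg i; exists d => //; exists (g i).
Qed.

(** Pigeonhole: a monomial of degree at least [n.+1 * M] has some exponent at least [M]. *)
Lemma coord_gr_pow_sub (L : R -> Prop) (M : nat) : is_ideal L ->
  (forall i, L (\pi_R 'X_i ^+ M)) ->
  forall (d : nat) f, (n.+1 * M <= d)%N -> gr d%:Z f -> L f.
Proof.
move=> idL hL d _ dM [f hf ->]; rewrite (mpolyE f) rmorph_sum /=.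
rewrite big_seq; apply: ideal_sum => // m mf.
have [L0 LD LM] := idL; rewrite -mul_mpolyC rmorphM; apply: (LM).
have /dhomogP/(_ m mf) /= md := hf.
have [i hi] : exists i, (M <= m i)%N.
  apply: contrapT => /forallNP hn.
  have [M0|M0] := posnP M; first by apply: (hn ord0); rewrite M0.
  have : (mdeg m <= \sum_(i < n.+1) M.-1)%N.
    rewrite mdegE; apply: leq_sum => i _; have /negP := hn i; lia.
  by rewrite md sum_nat_const card_ord; nia.
rewrite mpolyXE_id (bigD1 i) //= rmorphM mulrC; apply: (LM).
by rewrite -(subnK hi) exprD rmorphM; apply: LM; rewrite rmorphXn; exact: hL.
Qed.

End Graded.

(** * Homogeneous primes *)

Section PrimeAvoiding.
Variable A : comNzRingType.

Lemma ideal_prime_idealr (M : A -> Prop) : is_ideal M -> ~ M 1 ->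
  (forall x y, M (x * y) -> M x \/ M y) ->
  exists q : prime_idealr A, forall x, x \in q <-> M x.
Proof.
move=> [M0 MD MM] M1 Mprime.
pose S : pred A := fun x => `[< M x >].
have SP x : x \in S <-> M x by split=> /asboolP.
have S1 : idealr_closed S.
  split; [exact/SP | by apply/negP => /SP |].
  by move=> a x y /SP hx /SP hy; apply/SP/MD => //; exact: MM.
have S2 : prime_idealr_closed S.
  by move=> x y /SP/Mprime[] h; apply/orP; [left|right]; exact/SP.
pose q : prime_idealr A := HB.pack (S : A -> bool) (isIdealr.Build A S S1)
  (isPrimeIdealrClosed.Build A S S2).
by exists q.
Qed.

(** Zorn's lemma gives an ideal maximal among those that contain [L] and no power of [f]. It is
    prime: if it contained [x * y] but neither factor, its enlargements by [x] and by [y] would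
    contain powers of [f] whose product lies in it. *)
Lemma prime_avoiding (L : A -> Prop) (f : A) : is_ideal L ->
  (forall N, ~ L (f ^+ N)) ->
  exists q : prime_idealr A, (forall x, L x -> x \in q) /\ f \notin q.
Proof.
move=> idL Lf.
pose good (M : A -> Prop) :=
  [/\ is_ideal M, forall x, L x -> M x & forall N, ~ M (f ^+ N)].
pose T := {M | good M}; pose leT (M N : T) : bool := `[< forall x, sval M x -> sval N x >].
have goodL : good L by [].
have [] := @classical_sets.ZL_preorder T (exist _ L goodL) leT.
- by move=> M; apply/asboolP.
- by move=> M N Q /asboolP h1 /asboolP h2; apply/asboolP => x /h1/h2.
- move=> F Ftot.
  have [[M0 FM0]|Fempty] := pselect (exists M, F M); last first.
    by exists (exist _ L goodL) => M FM; case: Fempty; exists M.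
  pose U x := exists2 M : T, F M & sval M x.
  have goodU : good U.
    split=> [|x Lx|N [M FM]]; last by have [_ _ /(_ N)] := svalP M.
      split=> [|x y [M FM Mx] [N FN Ny]|a x [M FM Mx]].
      - by exists M0 => //; have [[]] := svalP M0.
      - have [/asboolP h|/asboolP h] := Ftot M N FM FN.
        + by exists N => //; have [[_ D _] _ _] := svalP N; apply: D => //; exact: h.
        + by exists M => //; have [[_ D _] _ _] := svalP M; apply: D => //; exact: h.
      - by exists M => //; have [[_ _ D] _ _] := svalP M; exact: D.
    by exists M0 => //; have [_ h _] := svalP M0; exact: h.
  exists (exist _ U goodU) => M FM; apply/asboolP => x Mx; by exists M.
move=> [M [[M0 MD MM] LM Mf]] Mmax.
have grow x : ~ M x -> exists N a m, M m /\ f ^+ N = m + a * x.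
  move=> Mx; apply: contrapT => hn.
  pose M' z := exists a m, M m /\ z = m + a * x.
  have goodM' : good M'.
    split=> [|z /LM Mz|N [a [m [Mm e]]]]; last by apply: hn; exists N, a, m.
    - split=> [|u v [a [m [Mm ->]]] [b [m' [Mm' ->]]]|c u [a [m [Mm ->]]]].
      + by exists 0, 0; split=> //; ring.
      + by exists (a + b), (m + m'); split; [exact: (MD) | ring].
      + by exists (c * a), (c * m); split; [exact: (MM) | ring].
    - by exists 0, z; split=> //; ring.
  have /asboolP := Mmax (exist _ M' goodM') (asboolT (fun z Mz =>
    ex_intro _ 0 (ex_intro _ z (conj Mz (esym (etrans (congr1 _ (mul0r x)) (addr0 z))))))).
  by move=> /(_ x) /= h; apply/Mx/h; exists 1, 0; split=> //; ring.
have [x y Mxy|q qM] := @ideal_prime_idealr M (And3 M0 MD MM) (Mf 0%N).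
  have [Mx|/grow[N [a [m [Mm e]]]]] := pselect (M x); first by left.
  have [My|/grow[N' [a' [m' [Mm' e']]]]] := pselect (M y); first by right.
  case: (Mf (N + N')%N); rewrite exprD e e'.
  have -> : (m + a * x) * (m' + a' * y) =
    (m' + a' * y) * m + ((a * x) * m' + (a * a') * (x * y)) by ring.
  by apply: (MD _ _ (MM _ _ Mm) (MD _ _ (MM _ _ Mm') (MM _ _ Mxy))).
exists q; split=> [x /LM/qM //|]; by apply/negP => /qM; exact: (Mf 1%N).
Qed.

End PrimeAvoiding.

Section Points.
Variables (K : fieldType) (n : nat) (I : idealr {mpoly K[n.+1]}).
Local Notation P := {mpoly K[n.+1]}.
Local Notation R := {ideal_quot I}.
Local Notation gr := (@coord_gr K n I).
Hypothesis I_homog : homog_ideal (@poly_gr K n) (fun f => f \in I).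

Section Regrade.
Variable q : prime_idealr R.
Local Notation S := {ideal_quot q}.

(* The map that sends f in P_d to the residue class of f times 'X^d. *)
Let regrade : P -> {poly S} :=
  mmap (polyC \o (\pi_S \o @coord_const K n I))
    (fun i => (\pi_S (\pi_R 'X_i))%:P * 'X).

Let regradeM : {morph regrade : f g / f * g}.
Proof. by move=> f g; rewrite /regrade rmorphM. Qed.

Let regradeE f : regrade f =
  \sum_(m <- msupp f) (\pi_S (\pi_R (f@_m *: 'X_[m])))%:P * 'X^(mdeg m).
Proof.
rewrite /regrade /mmap; apply: eq_bigr => m _ /=.
rewrite -mul_mpolyC !rmorphM /= -mulrA; congr (_ * _).
rewrite /mmap1 mpolyXE_id mdegE -prodrXr !rmorph_prod -big_split /=.
by apply: eq_bigr => i _; rewrite exprMn !rmorphXn.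
Qed.

Let coef_regrade f d : (regrade f)`_d = \pi_S (homog_part d (\pi_R f)).
Proof.
rewrite regradeE coef_sum homog_part_pi // pihomogE !rmorph_sum /= [RHS]big_mkcond /=.
apply: eq_bigr => m _; rewrite coefCM coefXn eq_sym.
by case: eqP; rewrite ?mulr1 ?mulr0.
Qed.

(** The homogeneous core of [q] pulls back to the kernel of [regrade], and [{poly S}] has no zero
    divisors because [q] is prime. This turns an arbitrary prime into a candidate point of Proj. *)
Lemma homog_core_prime :
  exists q' : prime_idealr R, forall x, x \in q' <-> forall d, homog_part d x \in q.
Proof.
have qS (x : R) : \pi_S x = 0 <-> x \in q.
  rewrite -[X in _ <-> is_true (X \in _)]subr0 Quotient.idealrBE.
  by rewrite -(rmorph0 \pi_S); split=> [->|/eqP].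
have domS (u v : S) : u * v = 0 -> u = 0 \/ v = 0.
  rewrite -[u]reprK -[v]reprK -rmorphM => /qS.
  by rewrite prime_idealrM => /orP[] /qS; [left|right].
have kerP f : regrade f = 0 <-> forall d, homog_part d (\pi_R f) \in q.
  split=> [h d|h]; first by apply/qS; rewrite -coef_regrade h coef0.
  by apply/polyP => d; rewrite coef0 coef_regrade; apply/qS.
apply: ideal_prime_idealr => [|h|x y].
- split=> [d|x y hx hy d|a x].
  + by rewrite homog_part0 ?idealr0.
  + by rewrite homog_partD // rpredD.
  + have [f ->] := coord_piP a; have [g ->] := coord_piP x.
    by rewrite -rmorphM => /kerP h; apply/kerP; rewrite regradeM h mulr0.
- have := h 0%N; rewrite homog_part_id ?idealr1 //; exact: coord_gr1.
have [f ->] := coord_piP x; have [g ->] := coord_piP y.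
rewrite -rmorphM => /kerP; rewrite regradeM => fg0.
have [/kerP|f0] := eqVneq (regrade f) 0; first by left.
have [/kerP|g0] := eqVneq (regrade g) 0; first by right.
(* Absence of zero divisors is known for [S] only, through [domS], so it is applied to leading
   coefficients. *)
have : lead_coef (regrade f) * lead_coef (regrade g) != 0.
  apply/negP => /eqP /domS[] /eqP; rewrite lead_coef_eq0.
  - by move=> e; move: f0; rewrite e.
  - by move=> e; move: g0; rewrite e.
by move=> h; have := lead_coef_proper_mul h; rewrite fg0 lead_coef0 => e; rewrite -e eqxx in h.
Qed.

End Regrade.

Variables (s : nat) (p : 'I_s -> prime_idealr R).
Hypothesis X_dim0 : proj_dim0 gr.
Hypothesis supp_X : enumerates_closed_points gr p.

Lemma homog_core_ideal (q q' : prime_idealr R) :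
  (forall x, x \in q' <-> forall d, homog_part d x \in q) ->
  homog_ideal gr (fun x => x \in q').
Proof.
move=> q'E; apply/homog_idealP => //.
  split; [exact: idealr0 | by move=> x y; exact: rpredD | by move=> a x; exact: idealMr].
move=> d x /q'E h; apply/q'E => e.
have [<-|ne] := eqVneq d e; first by rewrite homog_part_id //; exact: homog_part_gr.
by rewrite (homog_part_ne I_homog (homog_part_gr d x)) ?idealr0 //; exact/eqP.
Qed.

(* Otherwise L is contained in a homogeneous prime that misses a variable, and
   this prime is one of the points. *)
Lemma irrelevant_sub (L : R -> Prop) : is_ideal L ->
  (forall d x, L x -> L (homog_part d x)) ->
  (forall k, exists2 u, L u & u \notin p k) ->
  exists N, forall (d : nat) f, (N <= d)%N -> gr d%:Z f -> L f.
Proof.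
move=> idL Lhom Lp.
suff /choice[M hM] i : exists M, L (\pi_R 'X_i ^+ M).
  exists (n.+1 * \sum_i M i)%N => d f; apply: coord_gr_pow_sub => // i.
  rewrite (bigD1 i) //= addnC exprD; case: idL => _ _; exact.
apply: contrapT => /forallNP h.
have [q [Lq qi]] := prime_avoiding idL h.
have [q' q'E] := homog_core_prime q.
have q'i : \pi_R 'X_i \notin q'.
  apply/negP => /q'E /(_ 1%N); rewrite homog_part_id ?(negPf qi) //.
  exact: coord_gr_var.
have q'pt : proj_point gr q'.
  split; first exact: homog_core_ideal q'E.
  by exists 1, (\pi_R 'X_i); split=> //; exact: coord_gr_var.
(* In dimension 0 every point of Proj is closed. *)
have [k qk] : exists k, q' =i p k.
  have [_ _] := supp_X; apply; split=> // q1 hq1.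
  by have [_] := X_dim0; apply.
have [u Lu /negP[]] := Lp k.
by rewrite -qk; apply/q'E => d; exact/Lq/Lhom.
Qed.

End Points.

(** * Multiplication by x0 *)

Section Regularity.
Variables (K : fieldType) (n : nat) (I : idealr {mpoly K[n.+1]}).
Local Notation R := {ideal_quot I}.
Local Notation gr := (@coord_gr K n I).
Local Notation x0 := (x0 I).
Local Notation const := (@coord_const K n I).
Hypothesis I_homog : homog_ideal (@poly_gr K n) (fun f => f \in I).
Hypothesis I_saturated : saturated (@poly_gr K n) (fun f => f \in I).
Variables (s : nat) (p : 'I_s -> prime_idealr R).
Hypothesis X_dim0 : proj_dim0 gr.
Hypothesis supp_X : enumerates_closed_points gr p.
Hypothesis supp_x0 : forall j, x0 \notin p j.

(** The multipliers that send [x] into [J] form an ideal that is stable under homogeneous parts and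
    lies in no [p k]. By [irrelevant_sub] it contains all forms of large degree, and saturation puts
    [x] in [J]. *)
Lemma saturated_local (J : R -> Prop) (e : nat) x :
  is_ideal J -> (forall d y, J y -> J (homog_part d y)) -> saturated gr J ->
  gr e%:Z x -> (forall k, exists2 u, J (u * x) & u \notin p k) -> J x.
Proof.
move=> idJ homJ satJ hx hp; have [J0 JD JM] := idJ.
have idL : is_ideal (fun u => J (u * x)).
  split=> [|u v hu hv|a u hu]; first by rewrite mul0r.
  - by rewrite mulrDl; exact: JD.
  - by rewrite -mulrA; exact: JM.
have homL d u : J (u * x) -> J (homog_part d u * x).
  by rewrite ![_ * x]mulrC -(homog_part_mul I_homog d u hx); exact: homJ.
have [N hN] := irrelevant_sub I_homog X_dim0 supp_X idL homL hp.
exact: (saturated_mem (N := N)).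
Qed.

(** Powers of [x0] avoid every [p k], so the local criterion applies to each homogeneous part. *)
Lemma saturated_x0 (J : R -> Prop) N x :
  is_ideal J -> (forall d y, J y -> J (homog_part d y)) -> saturated gr J ->
  J (x0 ^+ N * x) -> J x.
Proof.
move=> idJ homJ satJ hx; apply: (ideal_homog_partP I_homog) => // d.
apply: (@saturated_local _ d) => //; first exact: homog_part_gr.
move=> k; exists (x0 ^+ N); last exact: prime_expn.
by rewrite -(homog_part_mul I_homog d x (coord_gr_x0X I N)); exact: homJ.
Qed.

Lemma x0_nzd N x : x0 ^+ N * x = 0 -> x = 0.
Proof.
apply: (@saturated_x0 (fun y => y = 0)); first exact: zero_ideal.
  by move=> d y ->; rewrite homog_part0.
exact: zero_saturated.
Qed.

Lemma x0_lreg N : GRing.lreg (x0 ^+ N).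
Proof.
move=> x y /eqP; rewrite -subr_eq0 -mulrBr => /eqP/x0_nzd/eqP.
by rewrite subr_eq0 => /eqP.
Qed.

Variables (r : nat) (D : nat).
Hypothesis r_reg : forall i : int, (r%:Z <= i)%R -> hilbert_function I i = D.

Lemma gr_basis (d : nat) : (r <= d)%N ->
  exists b : 'I_D -> R, quot_basis const (gr d%:Z) zero b.
Proof.
move=> rd; have [m [b hb]] := coord_gr_basis d (zero_subspace const).
have <- : hilbert_function I d%:Z = D by apply: r_reg; rewrite lez_nat.
exact: quot_basis_of_dim hb.
Qed.

Lemma sum_mull (g : R) m (c : 'I_m -> K) (b : 'I_m -> R) :
  \sum_i const (c i) * (g * b i) = g * \sum_i const (c i) * b i.
Proof. by rewrite mulr_sumr; apply: eq_bigr => i _; rewrite mulrCA. Qed.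

(** Multiplication by [x0 ^+ d] is injective from R_r to R_(d+r), and both spaces have dimension
    [D]. *)
Lemma gr_x0_div (d : nat) y : gr (d + r)%N%:Z y ->
  exists2 h, gr r%:Z h & y = x0 ^+ d * h.
Proof.
move=> hy; have [b hb] := gr_basis (leqnn r).
have [b' hb'] := gr_basis (leq_addl d r).
have [Vb _ bfree] := hb.
have Vv i : gr (d + r)%N%:Z (x0 ^+ d * b i).
  by rewrite PoszD; apply: coord_grM => //; exact: coord_gr_x0X.
have [|_ /(_ erefl)[_ vspan _]] := quot_basis_indep (zero_subspace const) hb' Vv.
  by move=> c; rewrite sum_mull => /x0_nzd; exact: bfree.
have [c /eqP] := vspan _ hy; rewrite subr_eq0 sum_mull => /eqP ->.
exists (\sum_i const (c i) * b i) => //.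
by apply: subspace_lin => //; exact: coord_gr_subspace.
Qed.

(* Fitting's lemma for multiplication by g / x0^d on R_(x0). *)
Lemma gr_fitting (d : nat) g y : gr d%:Z g -> gr (d + r)%N%:Z y ->
  exists h k, gr r%:Z h /\ g ^+ k * (y - g * h) = 0.
Proof.
(* [N] collects what some power of [g] kills; modulo [N], multiplication by [g] is injective. *)
move=> hg hy; pose N (x : R) := exists k, g ^+ k * x = 0.
have hN : is_subspace const N.
  split=> [|c x z [k e] [l e']]; first by exists 0%N; rewrite mulr0.
  exists (k + l)%N; rewrite exprD.
  have -> : g ^+ k * g ^+ l * (const c * x + z) =
    g ^+ l * const c * (g ^+ k * x) + g ^+ k * (g ^+ l * z) by ring.
  by rewrite e e' !mulr0 addr0.
have [m [b [Vb bspan bfree]]] := coord_gr_basis r hN.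
(* Multiplication by [x0 ^+ d] carries a basis of R_r modulo [N] to one of R_(d+r) modulo [N]. The
   products [g * b i] are as many and independent, so they span as well. *)
have [bd bdspan] : (forall i, gr (d + r)%N%:Z (x0 ^+ d * b i)) /\
    forall x, gr (d + r)%N%:Z x -> exists c : 'I_m -> K,
      N (x - \sum_i const (c i) * (x0 ^+ d * b i)).
  split=> [i|_ /gr_x0_div[h hh ->]].
    by rewrite PoszD; apply: coord_grM => //; exact: coord_gr_x0X.
  have [c [k e]] := bspan h hh; exists c, k.
  by rewrite sum_mull -mulrBr mulrCA e mulr0.
have bdfree (c : 'I_m -> K) :
    N (\sum_i const (c i) * (x0 ^+ d * b i)) -> forall i, c i = 0.
  rewrite sum_mull => -[k]; rewrite mulrCA => /x0_nzd e.
  by apply: bfree; exists k.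
have gd i : gr (d + r)%N%:Z (g * b i) by rewrite PoszD; exact: coord_grM.
have [|_ /(_ erefl)[_ gspan _]] :=
    quot_basis_indep hN (And3 bd bdspan bdfree) gd.
  move=> c; rewrite sum_mull => -[k]; rewrite mulrA -exprSr => e.
  by apply: bfree; exists k.+1.
have [c [k e]] := gspan y hy; exists (\sum_i const (c i) * b i), k.
split; first by apply: subspace_lin => //; exact: coord_gr_subspace.
by rewrite -sum_mull.
Qed.

(** In [gr_fitting] for [x0 ^+ (d + r)], the power of a non-zerodivisor [g] can be cancelled. Every
    homogeneous denominator can thus be traded for a power of [x0]. *)
Lemma homog_nzd_div (d : nat) g : gr d%:Z g -> is_nzd g ->
  exists2 h, gr r%:Z h & g * h = x0 ^+ (d + r).
Proof.
move=> hg gnz; have [h [k [hh e]]] := gr_fitting hg (coord_gr_x0X I (d + r)).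
exists h => //; elim: k e => [|k IH]; last by rewrite exprS -mulrA => /gnz.
by rewrite mul1r => /eqP; rewrite subr_eq0 => /eqP.
Qed.

End Regularity.

(** * The homogeneous ring of quotients *)

Section HomogeneousQuotients.
Variables (K : fieldType) (n : nat) (I : idealr {mpoly K[n.+1]}).
Local Notation R := {ideal_quot I}.
Local Notation gr := (@coord_gr K n I).
Local Notation Q := (hquot I).
Local Notation iota := (@to_hquot K n I).
Local Notation x0 := (x0 I).
Local Notation const := (@coord_const K n I).
Local Notation S := (homog_nzds I).

Lemma to_hquot_zmod : zmod_morphism iota.
Proof.
move=> f g; have S1 : S 1 by exact: ms_one.
by rewrite /to_hquot (fracB f g S1 S1) !mulr1.
Qed.

Lemma to_hquot_monoid : monoid_morphism iota.
Proof.
have S1 : S 1 by exact: ms_one.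
split=> [|f g]; first exact: frac1.
by rewrite /to_hquot (fracM f g S1 S1) mulr1.
Qed.

HB.instance Definition _ := GRing.isZmodMorphism.Build R Q iota to_hquot_zmod.
HB.instance Definition _ := GRing.isMonoidMorphism.Build R Q iota to_hquot_monoid.

Lemma to_hquotM f g : iota (f * g) = iota f * iota g.
Proof. exact: rmorphM. Qed.

Lemma to_hquotX f m : iota (f ^+ m) = iota f ^+ m.
Proof. exact: rmorphXn. Qed.

Lemma to_hquotD f g : iota (f + g) = iota f + iota g.
Proof. exact: rmorphD. Qed.

Lemma to_hquot0 : iota 0 = 0.
Proof. exact: rmorph0. Qed.

Lemma to_hquot_sum (T : Type) (l : seq T) (F : T -> R) :
  iota (\sum_(i <- l) F i) = \sum_(i <- l) iota (F i).
Proof. exact: rmorph_sum. Qed.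

Lemma to_hquot_inj : injective iota.
Proof.
have S1 : S 1 by exact: ms_one.
move=> f g; rewrite /to_hquot !fracE => /mkfracP[t /asboolP[_ tnz]].
rewrite !SubK !mulr1 => /tnz /eqP; rewrite subr_eq0 => /eqP //.
Qed.

Lemma frac_mulK f g : S g -> (Defs.frac S f g : Q) * iota g = iota f.
Proof.
move=> Sg; have S1 : S 1 by exact: ms_one.
have -> : (Defs.frac S f g : Q) * iota g = Defs.frac S (f * g) (g * 1).
  exact: (fracM f g Sg S1).
by rewrite mulr1 /to_hquot (fracE _ Sg) (fracE _ S1); apply: mkfrac_eq; rewrite !SubK !mulr1.
Qed.

Lemma to_hquot_unit g : S g -> iota g \is a GRing.unit.
Proof.
move=> Sg; apply/unitrP; exists (Defs.frac S 1 g).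
have e : (Defs.frac S 1 g : Q) * iota g = 1 by rewrite -(rmorph1 iota); exact: frac_mulK.
split; first exact: e.
by rewrite mulrC.
Qed.

Lemma hquot_frac (q : Q) : exists f g, S g /\ q * iota g = iota f.
Proof.
elim/locW: q => f [g Sg]; exists f, g; split=> //.
rewrite -(frac_mulK f Sg); congr (_ * _).
by rewrite (fracE _ Sg); congr mkfrac; exact: val_inj.
Qed.

Hypothesis I_homog : homog_ideal (@poly_gr K n) (fun f => f \in I).
Hypothesis I_saturated : saturated (@poly_gr K n) (fun f => f \in I).
Variables (s : nat) (p : 'I_s -> prime_idealr R).
Hypothesis X_dim0 : proj_dim0 gr.
Hypothesis supp_X : enumerates_closed_points gr p.
Hypothesis supp_x0 : forall j, x0 \notin p j.
Variables (r : nat) (D : nat).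
Hypothesis r_reg : forall i : int, (r%:Z <= i)%R -> hilbert_function I i = D.

Let x0_nzd := x0_nzd I_homog I_saturated X_dim0 supp_X supp_x0.

Lemma x0X_nzds N : S (x0 ^+ N).
Proof.
apply/asboolP; split; first by exists N%:Z; exact: coord_gr_x0X.
by move=> y /x0_nzd.
Qed.

Lemma x0_unit : iota x0 \is a GRing.unit.
Proof. by apply: to_hquot_unit; have := x0X_nzds 1. Qed.

Lemma x0X_unit N : iota x0 ^+ N \is a GRing.unit.
Proof. exact: unitrX x0_unit. Qed.

Lemma homog_nzds_div g : S g ->
  exists (e : nat) h, [/\ gr e%:Z g, gr r%:Z h & g * h = x0 ^+ (e + r)].
Proof.
move=> /asboolP[[[e|e] hg] gnz]; last first.
  move: gnz; rewrite (coord_gr_neg hg) => /(_ 1); rewrite mul0r => /(_ erefl).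
  by move/eqP; rewrite oner_eq0.
have [h hh gh] :=
  homog_nzd_div I_homog I_saturated X_dim0 supp_X supp_x0 r_reg hg gnz.
by exists e, h.
Qed.

(** This is the equality of Q^h(R) with the localization of R at x0. *)
Lemma hquot_elim (q : Q) : exists m f, q * iota x0 ^+ m = iota f.
Proof.
have [f [g [Sg qg]]] := hquot_frac q.
have [e [h [_ _ gh]]] := homog_nzds_div Sg.
exists (e + r)%N, (f * h).
by rewrite -rmorphXn -gh !rmorphM mulrA /= qg.
Qed.

Lemma hquot_gr_elim (d : int) (q : Q) : hquot_gr d q ->
  exists (m : nat) f, gr (d + m%:Z) f /\ q * iota x0 ^+ m = iota f.
Proof.
move=> [i [j [f [g [hf hg Sg -> qE]]]]].
have qg : q * iota g = iota f by rewrite qE; exact: frac_mulK.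
have [e [h [he hh gh]]] := homog_nzds_div Sg.
have nz0 : g <> 0 by move=> g0; move: (ms_nz S); rewrite -g0 Sg.
(* A nonzero element has only one degree, so the two degrees known for the denominator agree. *)
have -> : j = e%:Z.
  case: j hg => [j|j] hg; last by case: nz0; exact: coord_gr_neg hg.
  have [->//|/eqP ne] := eqVneq j e; case: nz0.
  by rewrite -(homog_part_id I_homog he) (homog_part_ne I_homog hg).
exists (e + r)%N, (f * h); split.
  have -> : i - e%:Z + (e + r)%N%:Z = i + r%:Z by lia.
  exact: coord_grM.
by rewrite -rmorphXn -gh !rmorphM mulrA /= qg.
Qed.

Lemma hquot_gr_intro (d : int) (m : nat) (q : Q) f :
  gr (d + m%:Z) f -> q * iota x0 ^+ m = iota f -> hquot_gr d q.
Proof.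
move=> hf e; exists (d + m%:Z), m%:Z, f, (x0 ^+ m); split=> //.
- exact: coord_gr_x0X.
- exact: x0X_nzds.
- lia.
apply: (mulIr (x0X_unit m)); rewrite e.
by have /esym := frac_mulK f (x0X_nzds m); rewrite rmorphXn.
Qed.

Lemma to_hquot_gr d f : gr d f -> hquot_gr d (iota f).
Proof. by move=> hf; apply: (@hquot_gr_intro d 0 _ f); rewrite ?addr0 ?mulr1. Qed.

Lemma horner_const (h : {poly K}) :
  (map_poly (@hquot_const K n I) h).[iota x0] = iota (map_poly const h).[x0].
Proof.
rewrite -horner_map -map_poly_comp; congr (_.[_]); apply: eq_map_poly => c //.
Qed.

Lemma homog_part_horner_const (h : {poly K}) d :
  homog_part d (map_poly const h).[x0] = const h`_d * x0 ^+ d.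
Proof.
have szh : (size (map_poly const h) <= maxn (size h) d.+1)%N.
  by apply: leq_trans (leq_maxl _ _); exact: size_poly.
rewrite (horner_coef_wide _ szh) homog_part_sum //.
have dM : (d < maxn (size h) d.+1)%N by lia.
rewrite (bigD1 (Ordinal dM)) //= big1 ?addr0.
  rewrite coef_map homog_part_id // -[d%:Z]add0r.
  by apply: coord_grM; [exact: coord_gr_const | exact: coord_gr_x0X].
move=> i ne; apply: (@homog_part_ne _ _ _ I_homog _ i).
  rewrite coef_map.
  by have := coord_grM (coord_gr_const I h`_i) (coord_gr_x0X I i); rewrite add0r.
by move=> e; case/eqP: ne; apply: val_inj.
Qed.

(** Clearing denominators gives an equation in [R] whose part of degree m + m' + e involves a single
    coefficient of [h]. *)
Lemma L0_homog (e : nat) (q : Q) : hquot_gr e%:Z q -> L0 q ->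
  exists c, q = iota (const c * x0 ^+ e).
Proof.
move=> /hquot_gr_elim[m' [f [hf qf]]] [h [m qh]].
exists h`_(m + e); apply: (mulIr (x0X_unit m')).
rewrite qf -to_hquotX -to_hquotM; congr (iota _).
have e1 : q * iota x0 ^+ m = iota (map_poly const h).[x0].
  by rewrite qh horner_const divrK //; exact: x0X_unit.
have e2 : x0 ^+ m * f = x0 ^+ m' * (map_poly const h).[x0].
  apply: to_hquot_inj; rewrite !to_hquotM -e1 -qf !to_hquotX; ring.
have hf' : gr (m' + e)%N%:Z f by rewrite addnC PoszD.
have := congr1 (homog_part (m + (m' + e))) e2.
rewrite (homog_part_mul I_homog _ _ (coord_gr_x0X I m)) addnCA.
rewrite (homog_part_mul I_homog _ _ (coord_gr_x0X I m')) homog_part_horner_const.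
rewrite (homog_part_id I_homog hf') exprD.
have -> : x0 ^+ m' * (const h`_(m + e) * (x0 ^+ m * x0 ^+ e)) =
  x0 ^+ m * (const h`_(m + e) * x0 ^+ e * x0 ^+ m') by ring.
by move/(x0_lreg I_homog I_saturated X_dim0 supp_X supp_x0).
Qed.

Lemma L0_poly (h : {poly K}) m :
  L0 (iota (map_poly const h).[x0] / iota x0 ^+ m).
Proof. by exists h, m; rewrite horner_const. Qed.

Lemma L0_const c : L0 (hquot_const I c).
Proof.
by have := L0_poly c%:P 0; rewrite map_polyC hornerC divr1.
Qed.

Lemma L0_0 : L0 (0 : Q).
Proof. by have := L0_const 0; rewrite /hquot_const !rmorph0. Qed.

Lemma L0_x0V m : L0 (iota x0 ^+ m)^-1.
Proof. by have := L0_poly 1 m; rewrite rmorph1 hornerC rmorph1 mul1r. Qed.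

Lemma L0_x0X m : L0 (iota x0 ^+ m).
Proof. by have := L0_poly 'X^m 0; rewrite map_polyXn hornerXn divr1 rmorphXn. Qed.

Lemma L0D (a b : Q) : L0 a -> L0 b -> L0 (a + b).
Proof.
move=> [h [m ->]] [h' [m' ->]]; rewrite !horner_const.
have := L0_poly (h * 'X^m' + h' * 'X^m) (m + m').
rewrite rmorphD !rmorphM /= !map_polyXn hornerD !hornerM !hornerXn.
rewrite to_hquotD !to_hquotM !to_hquotX.
set x := iota x0; set u := iota _; set v := iota _.
have -> // : (u * x ^+ m' + v * x ^+ m) / x ^+ (m + m') = u / x ^+ m + v / x ^+ m'.
have ux k : x ^+ k \is a GRing.unit by exact: x0X_unit.
apply: (mulIr (ux (m + m')%N)); rewrite divrK // exprD mulrDl !mulrA divrK //.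
by rewrite [v / _ * _]mulrAC divrK // mulrAC.
Qed.

Lemma L0_sum (T : Type) (l : seq T) (F : T -> Q) :
  (forall t, L0 (F t)) -> L0 (\sum_(t <- l) F t).
Proof.
by move=> h; apply: big_ind => [|x y|t _ //]; [exact: L0_0 | exact: L0D].
Qed.

End HomogeneousQuotients.

(** * The local rings *)

Section LocalRings.
Variables (K : fieldType) (n : nat) (I : idealr {mpoly K[n.+1]}).
Local Notation R := {ideal_quot I}.
Local Notation gr := (@coord_gr K n I).
Local Notation x0 := (x0 I).
Local Notation const := (@coord_const K n I).

Section OnePoint.
Variable q : prime_idealr R.
Local Notation O := (local_ring q).
Local Notation T := (homog_compls q).

Lemma homog_complP d g : gr d g -> g \notin q -> T g.
Proof. by move=> hg gq; apply/andP; split=> //; apply/asboolP; exists d. Qed.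

Lemma one_notin : 1 \notin q. Proof. by rewrite idealr1. Qed.

Lemma local_val_frac d f g : gr d f -> gr d g -> g \notin q ->
  local_val (local_frac q f g) = Defs.frac T f g.
Proof.
move=> hf hg gq; apply: (insubdK (0 : O)); apply/asboolP.
exists d, d, f, g; split=> //; first exact: homog_complP hg gq.
by rewrite subrr.
Qed.

Lemma local_frac_eqP d f g e f' g' : gr d f -> gr d g -> g \notin q ->
  gr e f' -> gr e g' -> g' \notin q ->
  local_frac q f g = local_frac q f' g' <->
  exists u, [/\ homog_elt u, u \notin q & u * (f * g' - f' * g) = 0].
Proof.
move=> hf hg gq hf' hg' gq'.
have Tg := homog_complP hg gq; have Tg' := homog_complP hg' gq'.
have -> : local_frac q f g = local_frac q f' g' <->
    Defs.frac T f g = Defs.frac T f' g'.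
  rewrite -(local_val_frac hf hg gq) -(local_val_frac hf' hg' gq').
  by split=> [->//|e1]; apply: val_inj.
rewrite (fracE _ Tg) (fracE _ Tg'); split=> [/mkfracP[u /andP[/asboolP hu uq]]|].
  by rewrite !SubK => e1; exists u.
move=> [u [hu uq e1]]; apply/mkfracP; exists u; last by rewrite !SubK.
by apply/andP; split=> //; apply/asboolP.
Qed.

Lemma local_fracP (a : O) : exists d f g,
  [/\ gr d f, gr d g, g \notin q & a = local_frac q f g].
Proof.
have /asboolP[i [j [f [g [hf hg Tg ij aE]]]]] : local_val a \in deg0_frac (p := q).
  exact: (valP a).
have /andP[_ gq] := Tg.
have e : j = i by apply/esym/eqP; rewrite -subr_eq0 -ij.
subst j; exists i, f, g; split=> //.
by apply: val_inj; rewrite [RHS](local_val_frac hf hg gq).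
Qed.

Lemma local_fracM d f g e f' g' : gr d f -> gr d g -> g \notin q ->
  gr e f' -> gr e g' -> g' \notin q ->
  local_frac q f g * local_frac q f' g' = local_frac q (f * f') (g * g').
Proof.
move=> hf hg gq hf' hg' gq'; apply: val_inj.
have gg' : g * g' \notin q by rewrite prime_idealrM negb_or gq.
rewrite [RHS](local_val_frac (coord_grM hf hf') (coord_grM hg hg') gg').
rewrite rmorphM /= (local_val_frac hf hg gq) (local_val_frac hf' hg' gq').
exact: fracM (homog_complP hg gq) (homog_complP hg' gq').
Qed.

Lemma local_fracB d f g e f' g' : gr d f -> gr d g -> g \notin q ->
  gr e f' -> gr e g' -> g' \notin q ->
  local_frac q f g - local_frac q f' g' = local_frac q (f * g' - f' * g) (g * g').
Proof.
move=> hf hg gq hf' hg' gq'; apply: val_inj.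
have gg' : g * g' \notin q by rewrite prime_idealrM negb_or gq.
have hn : gr (d + e) (f * g' - f' * g).
  by apply: coord_grB; [exact: coord_grM | rewrite addrC; exact: coord_grM].
rewrite [RHS](local_val_frac hn (coord_grM hg hg') gg').
rewrite rmorphB /= (local_val_frac hf hg gq) (local_val_frac hf' hg' gq').
exact: fracB (homog_complP hg gq) (homog_complP hg' gq').
Qed.

Lemma local_frac1 : local_frac q 1 1 = 1.
Proof.
apply: val_inj; rewrite rmorph1 /=.
rewrite (local_val_frac (coord_gr1 I) (coord_gr1 I) one_notin).
exact: frac1.
Qed.

Lemma local_const_zmod : zmod_morphism (@local_const K n I q).
Proof.
move=> x y; have hc c := coord_gr_const I c; have h1 := coord_gr1 I.
rewrite /local_const (local_fracB (hc x) h1 one_notin (hc y) h1 one_notin).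
by rewrite !mulr1 rmorphB.
Qed.

Lemma local_const_monoid : monoid_morphism (@local_const K n I q).
Proof.
have hc c := coord_gr_const I c; have h1 := coord_gr1 I.
split=> [|x y]; first by rewrite /local_const rmorph1 local_frac1.
rewrite /local_const (local_fracM (hc x) h1 one_notin (hc y) h1 one_notin).
by rewrite mulr1 rmorphM.
Qed.

HB.instance Definition _ :=
  GRing.isZmodMorphism.Build K O (@local_const K n I q) local_const_zmod.
HB.instance Definition _ :=
  GRing.isMonoidMorphism.Build K O (@local_const K n I q) local_const_monoid.

Hypothesis q_x0 : x0 \notin q.

Lemma x0X_notin N : x0 ^+ N \notin q.
Proof. exact: prime_expn. Qed.

Lemma germ_eqP (i j : nat) f g : gr i%:Z f -> gr j%:Z g ->
  germ q i f = germ q j g <->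
  exists u, [/\ homog_elt u, u \notin q & u * (f * x0 ^+ j - g * x0 ^+ i) = 0].
Proof.
move=> hf hg; exact: (local_frac_eqP hf (coord_gr_x0X I i) (x0X_notin i)
  hg (coord_gr_x0X I j) (x0X_notin j)).
Qed.

Lemma germ_x0 (k i : nat) f : gr i%:Z f -> germ q (k + i) (x0 ^+ k * f) = germ q i f.
Proof.
move=> hf; apply/germ_eqP => //.
  by rewrite PoszD; apply: coord_grM => //; exact: coord_gr_x0X.
exists 1; split; [by exists 0; exact: coord_gr1 | exact: one_notin|].
by rewrite exprD; ring.
Qed.

Lemma germM (i j : nat) f g : gr i%:Z f -> gr j%:Z g ->
  germ q i f * germ q j g = germ q (i + j) (f * g).
Proof.
move=> hf hg; rewrite /germ exprD.
exact: (local_fracM hf (coord_gr_x0X I i) (x0X_notin i)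
  hg (coord_gr_x0X I j) (x0X_notin j)).
Qed.

Lemma germB (i : nat) f g : gr i%:Z f -> gr i%:Z g ->
  germ q i (f - g) = germ q i f - germ q i g.
Proof.
move=> hf hg; rewrite -(germ_x0 i (coord_grB hf hg)) /germ exprD.
rewrite (local_fracB hf (coord_gr_x0X I i) (x0X_notin i)
  hg (coord_gr_x0X I i) (x0X_notin i)).
by rewrite mulrBr ![x0 ^+ i * _]mulrC.
Qed.

Lemma germ0 i : germ q i 0 = 0.
Proof. by have := germB (coord_gr0 I i%:Z) (coord_gr0 I i%:Z); rewrite !subrr. Qed.

Lemma germD (i : nat) f g : gr i%:Z f -> gr i%:Z g ->
  germ q i (f + g) = germ q i f + germ q i g.
Proof.
move=> hf hg; have := germB (coord_grD hf hg) hg; rewrite addrK => ->.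
by rewrite subrK.
Qed.

Lemma germ1 : germ q 0 1 = 1.
Proof. exact: local_frac1. Qed.

Lemma germX (i : nat) f N : gr i%:Z f -> germ q (i * N) (f ^+ N) = germ q i f ^+ N.
Proof.
move=> hf; elim: N => [|N IH]; first by rewrite muln0 germ1.
by rewrite !exprS mulnS -germM // ?IH //; exact: coord_grX.
Qed.

Lemma germZ c (i : nat) f : gr i%:Z f ->
  germ q i (const c * f) = local_const q c * germ q i f.
Proof. by move=> hf; rewrite -(germM (coord_gr_const I c) hf). Qed.

Lemma germ_sum (i : nat) m (c : 'I_m -> K) (f : 'I_m -> R) :
  (forall l, gr i%:Z (f l)) ->
  germ q i (\sum_l const (c l) * f l) = \sum_l local_const q (c l) * germ q i (f l).
Proof.
move=> hf; have [] // : gr i%:Z (\sum_l const (c l) * f l) /\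
  germ q i (\sum_l const (c l) * f l) = \sum_l local_const q (c l) * germ q i (f l).
elim/big_rec2: _ => [|l y x _ [hx <-]]; first by rewrite germ0; split=> //; exact: coord_gr0.
have h := coord_grZ (c l) (hf l).
by split; [exact: coord_grD | rewrite germD // germZ].
Qed.

Lemma germ_eq0 (i : nat) f : gr i%:Z f ->
  germ q i f = 0 <-> exists u, [/\ homog_elt u, u \notin q & u * f = 0].
Proof.
move=> hf; rewrite -(germ0 0) (germ_eqP hf (coord_gr0 I 0%N%:Z)).
by split=> -[u [hu uq]]; rewrite ?mul0r ?subr0 ?mulr1 => e; exists u;
  rewrite ?mul0r ?subr0 ?mulr1.
Qed.

Lemma nonunits_germ (i : nat) f : gr i%:Z f -> nonunits (germ q i f) <-> f \in q.
Proof.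
move=> hf; split=> [nu|fq [b]].
  apply: contrapT => /negP fq; apply: nu; exists (local_frac q (x0 ^+ i) f).
  have x0i := coord_gr_x0X I i.
  rewrite /germ (local_fracM x0i hf fq hf x0i (x0X_notin i)) -local_frac1.
  have fx : f * x0 ^+ i \notin q by rewrite prime_idealrM negb_or fq x0X_notin.
  have xf : gr (i%:Z + i%:Z) (x0 ^+ i * f) by exact: coord_grM.
  have fx' : gr (i%:Z + i%:Z) (f * x0 ^+ i) by exact: coord_grM.
  apply/(local_frac_eqP xf fx' fx (coord_gr1 I) (coord_gr1 I) one_notin).
  exists 1; split; [by exists 0; exact: coord_gr1 | exact: one_notin | by ring].
have [d [g [h [hg hh hq ->]]]] := local_fracP b.
have x0i := coord_gr_x0X I i.
have hx : h * x0 ^+ i \notin q by rewrite prime_idealrM negb_or hq x0X_notin.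
rewrite /germ (local_fracM hg hh hq hf x0i (x0X_notin i)) -local_frac1.
move=> /(local_frac_eqP (coord_grM hg hf) (coord_grM hh x0i) hx
  (coord_gr1 I) (coord_gr1 I) one_notin).
move=> [u [hu uq e]]; have : u * (h * x0 ^+ i) \in q.
  have -> : u * (h * x0 ^+ i) = (u * g) * f - u * (g * f * 1 - 1 * (h * x0 ^+ i)) by ring.
  by rewrite e subr0; exact: idealMr.
by rewrite prime_idealrM (negPf uq) (negPf hx).
Qed.

End OnePoint.

Hypothesis I_homog : homog_ideal (@poly_gr K n) (fun f => f \in I).
Hypothesis I_saturated : saturated (@poly_gr K n) (fun f => f \in I).
Variables (s : nat) (p : 'I_s -> prime_idealr R).
Hypothesis X_dim0 : proj_dim0 gr.
Hypothesis supp_X : enumerates_closed_points gr p.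
Hypothesis supp_x0 : forall j, x0 \notin p j.
Variables (r : nat) (D : nat).
Hypothesis r_reg : forall i : int, (r%:Z <= i)%R -> hilbert_function I i = D.

(** For a fraction f / g, [gr_fitting] solves g h = x0^r f up to a power of [g], and this power is
    outside [p j]. *)
Lemma germ_surj j (a : local_ring (p j)) : exists2 h, gr r%:Z h & a = germ (p j) r h.
Proof.
have [[d|d] [f [g [hf hg gq ->]]]] := local_fracP a; last first.
  by move: gq; rewrite (coord_gr_neg hg) idealr0.
have hxf : gr (d + r)%N%:Z (x0 ^+ r * f).
  by rewrite addnC PoszD; apply: coord_grM => //; exact: coord_gr_x0X.
have [h [k [hh e]]] :=
  gr_fitting I_homog I_saturated X_dim0 supp_X supp_x0 r_reg hg hxf.
exists h => //; have x0r := coord_gr_x0X I r.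
apply/(local_frac_eqP hf hg gq hh x0r (x0X_notin (supp_x0 j) r)).
exists (g ^+ k); split; first by exists (d * k)%N%:Z; exact: coord_grX.
- exact: prime_expn.
- by rewrite -e; ring.
Qed.

(** [gr_fitting] gives f^N (x0^(2r) - f h) = 0. The second factor is outside [p j], since [f] is
    inside and [x0] is not, so the germ of f^N vanishes. *)
Lemma nonunits_nilpotent j (a : local_ring (p j)) : nonunits a -> exists N, a ^+ N = 0.
Proof.
have [f hf ->] := germ_surj a; move/(nonunits_germ (supp_x0 j) hf) => fp.
have x0rr := coord_gr_x0X I (r + r).
have [h [N [hh e]]] :=
  gr_fitting I_homog I_saturated X_dim0 supp_X supp_x0 r_reg hf x0rr.
exists N; rewrite -(germX (supp_x0 j) N hf).
have hN : gr (r * N)%N%:Z (f ^+ N) by exact: coord_grX.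
apply/(germ_eq0 (supp_x0 j) hN).
exists (x0 ^+ (r + r) - f * h); split; last by rewrite mulrC.
  exists (r + r)%N%:Z; apply: coord_grB => //.
  by rewrite PoszD; exact: coord_grM.
apply/negP => hp; have /negP := x0X_notin (supp_x0 j) (r + r); apply.
rewrite -(subrK (f * h) (x0 ^+ (r + r))); apply: rpredD => //.
by rewrite mulrC; exact: idealMr.
Qed.

Lemma germ_inj (i : nat) f : gr i%:Z f -> (forall j, germ (p j) i f = 0) -> f = 0.
Proof.
move=> hf h; apply: (saturated_local I_homog X_dim0 supp_X (J := fun x => x = 0) _ _ _ hf).
- exact: zero_ideal.
- by move=> d y ->; rewrite homog_part0.
- exact: zero_saturated.
- by move=> k; have /(germ_eq0 (supp_x0 k) hf)[u [_ uq e]] := h k; exists u.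
Qed.

Lemma germ_inj2 (i : nat) f g : gr i%:Z f -> gr i%:Z g ->
  (forall j, germ (p j) i f = germ (p j) i g) -> f = g.
Proof.
move=> hf hg h; apply/eqP; rewrite -subr_eq0; apply/eqP.
apply: (germ_inj (coord_grB hf hg)) => j.
by rewrite germB // h subrr.
Qed.

(** Otherwise [p k] would be contained in [p j], hence equal to it in dimension 0. *)
Lemma points_separated j k : k != j -> exists (d : nat) u,
  [/\ gr d%:Z u, u \in p k & u \notin p j].
Proof.
move=> kj; have [closed inj _] := supp_X.
apply: contrapT => hn; move/eqP: kj; apply; apply: inj => x.
have sub : {subset p k <= p j}.
  have [[pkh _] _] := closed k.
  move=> y yk; have [N [f [hf ->]]] := pkh y yk; apply: rpred_sum => i _.
  apply: contrapT => /negP ni; apply: hn; exists i, (f i).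
  by have [h1 h2] := hf i.
apply/idP/idP; first exact: sub.
by have [_ h] := X_dim0; apply: h sub _; case: (closed j); case: (closed k).
Qed.

(** This plays the part of the product decomposition of Q^h(R). Powers of separating forms have germ
    0 at their points, by nilpotency; their product [W] has germ 0 at every point but [p j], where
    its germ is a unit. *)
Lemma germ_lift j (a : local_ring (p j)) : exists h, [/\ gr r%:Z h,
  germ (p j) r h = a & forall k, k != j -> germ (p k) r h = 0].
Proof.
have /choice[w hw] (k : 'I_s) : exists w : nat * R, [/\ gr w.1%:Z w.2, w.2 \notin p j
    & k != j -> germ (p k) w.1 w.2 = 0].
  have [_|kj] := eqVneq k j.
    by exists (0%N, 1); split; [exact: coord_gr1 | exact: one_notin|].
  have [d [u [hu uk uj]]] := points_separated kj.
  have /nonunits_nilpotent[N e] := (nonunits_germ (supp_x0 k) hu).2 uk.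
  exists ((d * N)%N, u ^+ N); split; [exact: coord_grX | exact: prime_expn |].
  by rewrite /= germX.
pose e := (\sum_k (w k).1)%N; pose W := \prod_k (w k).2.
have hW : gr e%:Z W.
  rewrite /e /W; elim/big_rec2: _ => [|k x y _ hx]; first exact: coord_gr1.
  by rewrite PoszD; apply: coord_grM => //; have [] := hw k.
have Wj : W \notin p j.
  apply: (big_ind (fun x => x \notin p j)) => [|x y hx hy|k _]; first exact: one_notin.
    by rewrite prime_idealrM negb_or hx.
  by have [] := hw k.
have Wk k : k != j -> germ (p k) e W = 0.
  move=> kj; rewrite /e /W (bigD1 k) //= [X in germ _ _ X](bigD1 k) //=.
  have [h1 h2 h3] := hw k; rewrite -germM //.
    by rewrite h3 // mul0r.
  elim/big_rec2: _ => [|l x y _ hx]; first exact: coord_gr1.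
  by rewrite PoszD; apply: coord_grM => //; have [] := hw l.
have [b bW] : exists b, b * germ (p j) e W = 1.
  apply: contrapT => /(nonunits_germ (supp_x0 j) hW) Wj'.
  by move/negP: Wj; apply.
have [g hg abg] := germ_surj (a * b).
have hWg : gr (e + r)%N%:Z (W * g) by rewrite PoszD; exact: coord_grM.
(* Dividing by [x0 ^+ e] brings the degree down to [r] and leaves the germs unchanged. *)
have [h hh Wgh] := gr_x0_div I_homog I_saturated X_dim0 supp_X supp_x0 r_reg hWg.
exists h; split=> // [|k kj].
  rewrite -(germ_x0 (supp_x0 j) e hh) -Wgh -germM // -abg mulrCA.
  by rewrite [germ _ _ _ * b]mulrC bW mulr1.
by rewrite -(germ_x0 (supp_x0 k) e hh) -Wgh -germM // Wk // mul0r.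
Qed.

End LocalRings.

(** * Maximal subschemes *)

(** For each [x i] in turn, the current multiple of [t] is multiplied by the last power of [x i]
    that does not kill it. If the [x i] generate the maximal ideal, the result is a socle
    element. *)
Lemma nilpotent_annihilated (A : comNzRingType) m (x : 'I_m -> A) (t : A) :
  (forall i, exists N, x i ^+ N = 0) -> t <> 0 ->
  exists b, b * t <> 0 /\ forall i, x i * (b * t) = 0.
Proof.
elim: m x => [|m IH] x xnil t0.
  by exists 1; rewrite mul1r; split=> // i; have := ltn_ord i.
have [|b [bt0 hb]] := IH (x \o lift ord0) _ t0; first by move=> i; exact: xnil.
have [N xN] := xnil ord0.
have [k [k0 kS]] : exists k, x ord0 ^+ k * (b * t) <> 0 /\ x ord0 ^+ k.+1 * (b * t) = 0.
  apply: contrapT => hn.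
  have h k : x ord0 ^+ k * (b * t) <> 0.
    elim: k => [|k hk]; first by rewrite mul1r.
    by move=> e; apply: hn; exists k.
  by apply: (h N); rewrite xN mul0r.
exists (x ord0 ^+ k * b); rewrite -mulrA; split=> // i.
have [i0 ->|->] := unliftP ord0 i; last by rewrite mulrA -exprS.
by rewrite mulrCA (hb i0 : x (lift ord0 i0) * (b * t) = 0) mulr0.
Qed.

Section SocleQuotient.
Variables (K : fieldType) (A : comNzRingType) (k : {rmorphism K -> A}).

Lemma ideal_subspace (J : A -> Prop) : is_ideal J -> is_subspace k J.
Proof. by move=> [J0 JD JM]; split=> // c x y hx hy; apply: (JD) => //; exact: JM. Qed.

(* Multiplication by t induces an isomorphism from the residue field onto (t). *)
Lemma quot_basis_socle (t : A) m (b : 'I_m -> A) l (e : 'I_l -> A) :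
  t <> 0 -> (forall x, nonunits x -> x * t = 0) ->
  quot_basis k full (principal t) b -> quot_basis k full (@nonunits A) e ->
  exists v : 'I_(m + l) -> A, quot_basis k full (@zero A) v.
Proof.
move=> t0 tsoc [_ bspan bfree] [_ espan efree].
pose v i := match split i with inl i => b i | inr i => e i * t end.
have vE (c : 'I_(m + l) -> K) : \sum_i k (c i) * v i =
    \sum_i k (c (lshift l i)) * b i + (\sum_i k (c (rshift m i)) * e i) * t.
  rewrite big_split_ord mulr_suml /=; congr (_ + _); apply: eq_bigr => i _.
    by rewrite /v (unsplitK (inl i)).
  by rewrite /v (unsplitK (inr i)) mulrA.
exists v; split=> // [x _|c].
  have [c [a ha]] := bspan x I; have [d hd] := espan a I.
  exists (fun i => match split i with inl i => c i | inr i => d i end).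
  rewrite vE /zero opprD addrA.
  have -> : \sum_i k match split (lshift l i) with inl i => c i | inr i => d i end * b i
      = \sum_i k (c i) * b i.
    by apply: eq_bigr => i _; rewrite (unsplitK (inl i)).
  have -> : \sum_i k match split (rshift m i) with inl i => c i | inr i => d i end * e i
      = \sum_i k (d i) * e i.
    by apply: eq_bigr => i _; rewrite (unsplitK (inr i)).
  by rewrite ha -mulrBl tsoc.
rewrite vE /zero => h.
have cb : forall i, c (lshift l i) = 0.
  apply: (bfree (fun i => c (lshift l i))).
  exists (- (\sum_i k (c (rshift m i)) * e i)); rewrite mulNr.
  by apply/eqP; rewrite -addr_eq0 h.
(* If the combination of the [e i] were a unit, its product with [t] being 0 would force [t] to be
   0. *)
have ce : forall i, c (rshift m i) = 0.
  apply: (efree (fun i => c (rshift m i))) => -[y hy].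
  apply: t0; rewrite -[t]mul1r -hy -mulrA.
  move: h; under eq_bigr do rewrite cb rmorph0 mul0r.
  by rewrite big1_eq add0r => ->; rewrite mulr0.
by move=> i; rewrite -(splitK i); case: (split i) => a /=.
Qed.

End SocleQuotient.

Section Subschemes.
Variables (K : fieldType) (n : nat) (I : idealr {mpoly K[n.+1]}).
Local Notation R := {ideal_quot I}.
Local Notation gr := (@coord_gr K n I).
Local Notation x0 := (x0 I).
Local Notation const := (@coord_const K n I).

Section OnePoint.
Variable q : prime_idealr R.
Hypothesis q_x0 : x0 \notin q.

Lemma ideal_at_ideal (J : R -> Prop) : is_ideal J -> is_ideal (ideal_at (p := q) J).
Proof.
move=> [J0 JD JM]; have one0 := one_notin q; have g1 := coord_gr1 I.
have J00 : ideal_at (p := q) J 0.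
  by exists 0, 0, 1; split=> //; [exact: coord_gr0 | rewrite -(germ0 q_x0 0)].
have JB a b : ideal_at (p := q) J a -> ideal_at (p := q) J b -> ideal_at (p := q) J (a - b).
  move=> [d [f [g [hf hg Jf gq ->]]]] [d' [f' [g' [hf' hg' Jf' gq' ->]]]].
  exists (d + d'), (f * g' - f' * g), (g * g'); split.
  - by apply: coord_grB; [exact: coord_grM | rewrite addrC; exact: coord_grM].
  - exact: coord_grM.
  - rewrite mulrC; apply: (JD); first exact: JM.
    by rewrite mulrC -mulNr; exact: JM.
  - by rewrite prime_idealrM negb_or gq.
  - exact: local_fracB hf hg gq hf' hg' gq'.
split=> // [x y hx hy|a x [d [f [g [hf hg Jf gq ->]]]]].
  by rewrite -[y]opprK -[- y]sub0r; apply: (JB) => //; apply: (JB).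
have [d' [f' [g' [hf' hg' gq' ->]]]] := local_fracP a.
exists (d' + d), (f' * f), (g' * g); split.
- exact: coord_grM.
- exact: coord_grM.
- exact: JM.
- by rewrite prime_idealrM negb_or gq'.
- exact: local_fracM hf' hg' gq' hf hg gq.
Qed.

Lemma ideal_at_germ (J : R -> Prop) (i : nat) f : gr i%:Z f -> J f ->
  ideal_at (p := q) J (germ q i f).
Proof.
move=> hf Jf; exists i%:Z, f, (x0 ^+ i); split=> //; first exact: coord_gr_x0X.
exact: x0X_notin.
Qed.

Lemma ideal_at_germE (J : R -> Prop) (i : nat) f : is_ideal J -> gr i%:Z f ->
  ideal_at (p := q) J (germ q i f) -> exists2 u, J (u * f) & u \notin q.
Proof.
move=> [J0 JD JM] hf [d [f' [g' [hf' hg' Jf' gq']]]].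
move=> /(local_frac_eqP hf (coord_gr_x0X I i) (x0X_notin q_x0 i) hf' hg' gq')[u [_ uq e]].
exists (u * g'); last by rewrite prime_idealrM negb_or uq.
have -> : u * g' * f = u * x0 ^+ i * f' + u * (f * g' - f' * x0 ^+ i) by ring.
by rewrite e addr0; exact: JM.
Qed.

End OnePoint.

Hypothesis I_homog : homog_ideal (@poly_gr K n) (fun f => f \in I).
Hypothesis I_saturated : saturated (@poly_gr K n) (fun f => f \in I).
Variables (s : nat) (p : 'I_s -> prime_idealr R).
Hypothesis X_dim0 : proj_dim0 gr.
Hypothesis supp_X : enumerates_closed_points gr p.
Hypothesis supp_x0 : forall j, x0 \notin p j.
Variables (r : nat) (D : nat).
Hypothesis r_reg : forall i : int, (r%:Z <= i)%R -> hilbert_function I i = D.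

Lemma subscheme_mem (J : R -> Prop) (i : nat) f : is_subscheme J -> gr i%:Z f ->
  (forall k, ideal_at (p := p k) J (germ (p k) i f)) -> J f.
Proof.
move=> [idJ homJ satJ] hf h.
apply: (saturated_local I_homog X_dim0 supp_X idJ _ satJ hf).
  exact/(homog_idealP I_homog idJ).
move=> k; exact: ideal_at_germE (h k).
Qed.

(** This is the condition minimized by [mu], restated for one form instead of a family of
    polynomials; [mu_liftedE] links the two. *)
Definition lifted j (i : nat) (a : local_ring (p j)) : Prop :=
  exists h, [/\ gr i%:Z h, germ (p j) i h = a & forall k, k != j -> germ (p k) i h = 0].

Lemma mu_liftedE j (i : nat) (a : local_ring (p j)) :
  (exists v, [/\ @germs_image K n I s p v, v j = a *: 'X^i & forall k, k != j -> v k = 0]) <->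
  lifted i a.
Proof.
split=> [[v [[N [f [hf vE]]] vj vk]]|[h [hh hj hk]]]; last first.
  pose f l := if l == i then h else 0.
  exists (fun k => \sum_(l < i.+1) germ (p k) l (f l) *: 'X^l).
  have vE k : \sum_(l < i.+1) germ (p k) l (f l) *: 'X^l = germ (p k) i h *: 'X^i.
    rewrite big_ord_recr /= /f eqxx big1 ?add0r // => l _.
    by rewrite ltn_eqF // germ0 // scale0r.
  split; last by move=> k kj; rewrite vE hk // scale0r.
  - exists i.+1, f; split=> // l; rewrite /f; case: eqP => [->//|_]; exact: coord_gr0.
  - by rewrite vE hj.
(* The sum that presents [v] may stop before degree [i]; the form sought is then 0. *)
pose h := if (i < N)%N then f i else 0.
have coefv k : (v k)`_i = germ (p k) i h.
  rewrite vE coef_sum /h; case: ltnP => iN.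
    rewrite (bigD1 (Ordinal iN)) //= big1 ?addr0.
      by rewrite coefZ coefXn eqxx mulr1.
    move=> l ne; rewrite coefZ coefXn; case: eqP => [e|_]; last by rewrite mulr0.
    by case/eqP: ne; apply: val_inj.
  rewrite germ0 // big1 // => l _; rewrite coefZ coefXn.
  case: eqP => [e|_]; last by rewrite mulr0.
  by have := ltn_ord l; rewrite -e ltnNge iN.
exists h; split=> [||k kj].
- by rewrite /h; case: ifP => _ //; exact: coord_gr0.
- by rewrite -coefv vj coefZ coefXn eqxx mulr1.
- by rewrite -coefv vk // coef0.
Qed.

Lemma lifted_le j (i l : nat) (a : local_ring (p j)) : (i <= l)%N ->
  lifted i a -> lifted l a.
Proof.
move=> il [h [hh hj hk]]; exists (x0 ^+ (l - i) * h); rewrite -[in l%:Z](subnK il).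
split=> [||k kj]; first by rewrite PoszD; apply: coord_grM => //; exact: coord_gr_x0X.
- by rewrite -{1}(subnK il) germ_x0.
- by rewrite -{1}(subnK il) germ_x0 // hk.
Qed.

Lemma lifted_r j (a : local_ring (p j)) : lifted r a.
Proof. exact: germ_lift r_reg j a. Qed.

(** The condition [lifted] is monotone in the degree and holds at [r], so the minimum exists and is
    a threshold. *)
Lemma mu_le j (i : nat) (a : local_ring (p j)) : (mu a <= i)%N <-> lifted i a.
Proof.
pose P i := exists v, [/\ @germs_image K n I s p v, v j = a *: 'X^i
  & forall k, k != j -> v k = 0].
have spec i' : lifted i' a -> lifted (mu a) a /\ (mu a <= i')%N.
  move=> /mu_liftedE Pi; have [h ?] := @natmin_spec P i' Pi.
  by split=> //; apply/mu_liftedE.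
split=> [le|/spec[] //].
by have [h _] := spec r (lifted_r a); exact: lifted_le le h.
Qed.

Lemma local_basis j (W : local_ring (p j) -> Prop) :
  is_subspace (@local_const K n I (p j)) W ->
  exists m (b : 'I_m -> local_ring (p j)), quot_basis (@local_const K n I (p j)) full W b.
Proof.
move=> hW; have [b [Vb bspan _]] := gr_basis r_reg (leqnn r).
apply: (@quot_basis_exists _ _ _ _ _ _ (fun i => germ (p j) r (b i))) => // x _.
have [h /bspan[c /eqP]] := germ_surj I_homog I_saturated X_dim0 supp_X supp_x0 r_reg x.
rewrite subr_eq0 => /eqP -> ->; exists c.
by rewrite germ_sum // subrr; case: hW.
Qed.

Hypothesis X_local : forall j, is_local (local_ring (p j)).
Hypothesis X_noetherian : forall j, noetherian (local_ring (p j)).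

(** The maximal ideal has finitely many generators, all nilpotent. *)
Lemma socle_multiple j (t : local_ring (p j)) : t <> 0 ->
  exists b, b * t <> 0 /\ socle (b * t).
Proof.
move=> t0; have [m [x xE]] := X_noetherian (X_local j).
have [|b [bt hb]] := @nilpotent_annihilated _ m x t _ t0.
  move=> i; apply: (nonunits_nilpotent I_homog I_saturated X_dim0 supp_X supp_x0 r_reg).
  apply/xE; exists (fun l => if l == i then 1 else 0).
  by rewrite (bigD1 i) //= eqxx mul1r big1 ?addr0 // => l /negPf ->; rewrite mul0r.
exists b; split=> // y /xE[a ->]; rewrite mulr_suml big1 // => i _.
by rewrite -mulrA hb mulr0.
Qed.

Lemma residue_basis j : exists e : 'I_(residue_deg (p j)) -> local_ring (p j),
  quot_basis (@local_const K n I (p j)) full (@nonunits (local_ring (p j))) e.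
Proof.
have [m [b hb]] := local_basis (ideal_subspace (@local_const K n I (p j)) (X_local j)).
exact: quot_basis_of_dim hb.
Qed.

Lemma residue_deg_gt0 j : (0 < residue_deg (p j))%N.
Proof.
have [e [_ espan _]] := residue_basis j; rewrite lt0n; apply/negP => /eqP e0.
have [c] := espan 1 Logic.I; rewrite big1 ?subr0; first by case; exists 1; rewrite mulr1.
by move=> i; exfalso; have := ltn_ord i; rewrite [X in (_ < X)%N]e0.
Qed.

Lemma principal_dim j (t : local_ring (p j)) : t <> 0 -> socle t ->
  (quot_dim (@local_const K n I (p j)) full (principal t) + residue_deg (p j))%N
    = local_deg (p j).
Proof.
move=> t0 tsoc; have [e he] := residue_basis j.
have hP := ideal_subspace (@local_const K n I (p j)) (principal_ideal t).
have [m [b0 /quot_basis_of_dim[b hb]]] := local_basis hP.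
have [v hv] := quot_basis_socle t0 tsoc hb he.
exact/esym/(quot_basis_dim (zero_subspace _) hv).
Qed.

(** Away from [p j] the local ideals of [J] are zero, so the other summands of the two degrees
    cancel. *)
Lemma maximal_subscheme_dim j (J : R -> Prop) : point_subscheme p j J ->
  (sub_degree p J + residue_deg (p j))%N = degree p <->
  (quot_dim (@local_const K n I (p j)) full (ideal_at (p := p j) J) + residue_deg (p j))%N
    = local_deg (p j).
Proof.
move=> [[idJ _ _] Jk].
pose X := (\sum_(i | i != j) local_deg (p i))%N.
have -> : degree p = (local_deg (p j) + X)%N by rewrite /degree (bigD1 j).
have -> : sub_degree p J =
    (quot_dim (@local_const K n I (p j)) full (ideal_at (p := p j) J) + X)%N.
  rewrite /sub_degree (bigD1 j) //=; congr (_ + _)%N; apply: eq_bigr => k kj.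
  apply: quot_dim_eq => // a; split=> [|->]; first exact: Jk.
  by case: (ideal_at_ideal (supp_x0 k) idJ).
by split; lia.
Qed.

(** The local ideal at [p j] is nonzero, since its codimension is smaller than [local_deg] by the
    positive [residue_deg]. It therefore contains a nonzero socle element, which generates an ideal
    of the same codimension. *)
Lemma maximal_subscheme_socle j (J : R -> Prop) : maximal_subscheme p j J ->
  exists t : local_ring (p j), [/\ t <> 0, socle t &
    forall a, ideal_at J a <-> principal t a].
Proof.
move=> [hJ /(maximal_subscheme_dim hJ) dimJ]; have [[idJ _ _] _] := hJ.
have idJj := ideal_at_ideal (supp_x0 j) idJ; have [J0 JD JM] := idJj.
have hJj := ideal_subspace (@local_const K n I (p j)) idJj.
have [t0 Jt0 t0n0] : exists2 t0 : local_ring (p j), ideal_at J t0 & t0 <> 0.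
  apply: contrapT => hn; have := residue_deg_gt0 j.
  suff e : quot_dim (@local_const K n I (p j)) full (ideal_at (p := p j) J) = local_deg (p j).
    by move: dimJ; rewrite e; lia.
  apply: quot_dim_eq => // a; split=> [Ja|->//].
  by apply: contrapT => a0; apply: hn; exists a.
have [b [tn0 tsoc]] := socle_multiple t0n0.
exists (b * t0); split=> // a; split=> [Ja|[c ->]]; last by apply: (JM); exact: JM.
have hP := ideal_subspace (@local_const K n I (p j)) (principal_ideal (b * t0)).
have [m [c0 /quot_basis_of_dim[c hc]]] := local_basis hP.
have [m' [d0 /quot_basis_of_dim[d hd]]] := local_basis hJj.
have e : quot_dim (@local_const K n I (p j)) full (ideal_at (p := p j) J) =
   quot_dim (@local_const K n I (p j)) full (principal (b * t0)).
  by have := principal_dim tn0 tsoc; rewrite -dimJ; lia.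
move: d hd; rewrite e => d hd.
apply: (quot_basis_sub_eq _ hP hJj hc hd) => //.
by move=> x [u ->]; apply: (JM); exact: JM.
Qed.

(** The ideal consists of the elements all of whose homogeneous parts have germ 0 away from [p j]
    and germ in [principal t] at [p j]; maximality is then [principal_dim]. *)
Lemma socle_subscheme j (t : local_ring (p j)) : t <> 0 -> socle t ->
  exists J, maximal_subscheme p j J.
Proof.
move=> t0 tsoc.
pose ok (d : nat) f := (forall k, k != j -> germ (p k) d f = 0) /\
  principal t (germ (p j) d f).
have ok0 d : ok d 0.
  by split=> [k _|]; rewrite germ0 //; exists 0; rewrite mul0r.
have okD d f g : gr d%:Z f -> gr d%:Z g -> ok d f -> ok d g -> ok d (f + g).
  move=> hf hg [fk fj] [gk gj]; split=> [k kj|].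
    by rewrite germD // fk // gk // addr0.
  by rewrite germD //; case: (principal_ideal t) => _ D' _; exact: D'.
have okM d f e g : gr d%:Z f -> gr e%:Z g -> ok d f -> ok (e + d)%N (g * f).
  move=> hf hg [fk fj]; split=> [k kj|].
    by rewrite -germM // fk // mulr0.
  by rewrite -germM //; case: (principal_ideal t) => _ _; exact.
pose J f := forall d, ok d (homog_part d f).
have Jok d f : gr d%:Z f -> J f -> ok d f.
  by move=> hf /(_ d); rewrite homog_part_id.
have okJ d f : gr d%:Z f -> ok d f -> J f.
  move=> hf okf e; have [<-|/eqP ne] := eqVneq d e; first by rewrite homog_part_id.
  by rewrite (homog_part_ne I_homog hf).
have JD x y : J x -> J y -> J (x + y).
  by move=> hx hy d; rewrite homog_partD //; apply: okD => //; exact: homog_part_gr.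
have J0 : J 0 by move=> d; rewrite homog_part0.
have idJ : is_ideal J.
  split=> // a x Jx.
  have [N /(_ N (leqnn N)) ->] := homog_part_decomp I_homog a; rewrite mulr_suml.
  apply: (big_ind J) => // i _ d.
  have [di|id] := ltnP d i.
    by rewrite (homog_part_mul_lt I_homog x (homog_part_gr i a) di).
  rewrite -(subnKC id) (homog_part_mul I_homog _ x (homog_part_gr i a)).
  by apply: okM => //; exact: homog_part_gr.
have subJ : is_subscheme J.
  split=> //.
    apply/(homog_idealP I_homog idJ) => d x Jx; apply: (okJ d) => //; exact: homog_part_gr.
  (* Saturation is tested on the product [x0 ^+ k] alone, because multiplication by it does not
     change germs. *)
  move=> x k h d; have [] := h (fun _ => x0)
    (fun _ => ex_intro2 _ _ 1 isT (coord_gr_x0 I)) (k + d)%N.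
  rewrite prodr_const card_ord (homog_part_mul I_homog d x (coord_gr_x0X I k)).
  rewrite germ_x0 //; last exact: homog_part_gr.
  by move=> hk hj; split=> // l lj; rewrite -(hk l lj) germ_x0 //; exact: homog_part_gr.
have Jk k : k != j -> forall a, ideal_at (p := p k) J a -> a = 0.
  move=> kj a [[d|d] [f [g [hf hg Jf gq ->]]]]; last first.
    by move: gq; rewrite (coord_gr_neg hg) idealr0.
  have [/(_ k kj) + _] := Jok d f hf Jf.
  move=> /(germ_eq0 (supp_x0 k) hf)[u [hu uq e]].
  rewrite -(germ0 (supp_x0 k) 0).
  apply/(local_frac_eqP hf hg gq (coord_gr0 I 0) (coord_gr1 I) (one_notin _)).
  by exists u; rewrite mul0r subr0 mulr1.
have Jj a : ideal_at (p := p j) J a <-> principal t a.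
  split=> [[[d|d] [f [g [hf hg Jf gq ->]]]]|[c e]].
  - have [_ [c e]] := Jok d f hf Jf.
    have x0d := coord_gr_x0X I d; have x0n := x0X_notin (supp_x0 j) d.
    have -> : local_frac (p j) f g = local_frac (p j) (x0 ^+ d) g * germ (p j) d f.
      rewrite /germ (local_fracM x0d hg gq hf x0d x0n).
      have gx : g * x0 ^+ d \notin p j by rewrite prime_idealrM negb_or gq.
      apply/(local_frac_eqP hf hg gq (coord_grM x0d hf) (coord_grM hg x0d) gx).
      exists 1; split; [by exists 0; exact: coord_gr1 | exact: one_notin|].
      ring.
    by exists (local_frac (p j) (x0 ^+ d) g * c); rewrite e mulrA.
  - by move: gq; rewrite (coord_gr_neg hg) idealr0.
  - have [h [hh hj hk]] := lifted_r a.
    rewrite -hj; apply: ideal_at_germ => //; apply: (okJ r) => //.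
    by split=> //; rewrite hj; exists c.
have ptJ : point_subscheme p j J by split.
exists J; split=> //; apply/(maximal_subscheme_dim ptJ).
by rewrite -(principal_dim t0 tsoc); congr (_ + _)%N; exact: quot_dim_eq.
Qed.

Lemma maximal_subscheme_exists j : exists J, maximal_subscheme p j J.
Proof.
have one0 : 1 <> 0 :> local_ring (p j) by apply/eqP; exact: oner_neq0.
have [b [tn0 tsoc]] := socle_multiple one0.
exact: socle_subscheme tn0 tsoc.
Qed.

End Subschemes.

(** * The Dedekind different *)

Section Different.
Variables (K : fieldType) (n : nat) (I : idealr {mpoly K[n.+1]}).
Local Notation R := {ideal_quot I}.
Local Notation gr := (@coord_gr K n I).
Local Notation Q := (hquot I).
Local Notation iota := (@to_hquot K n I).
Local Notation x0 := (x0 I).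
Local Notation const := (@coord_const K n I).
Hypothesis I_homog : homog_ideal (@poly_gr K n) (fun f => f \in I).
Hypothesis I_saturated : saturated (@poly_gr K n) (fun f => f \in I).
Variables (s : nat) (p : 'I_s -> prime_idealr R).
Hypothesis X_dim0 : proj_dim0 gr.
Hypothesis supp_X : enumerates_closed_points gr p.
Hypothesis supp_x0 : forall j, x0 \notin p j.
Variables (r : nat) (D : nat).
Hypothesis r_reg : forall i : int, (r%:Z <= i)%R -> hilbert_function I i = D.
Variable sigma : Q -> Q.
Hypothesis sigma_trace : trace_map sigma.

Let x0_unit := x0_unit I_homog I_saturated X_dim0 supp_X supp_x0.
Let x0X_unit := x0X_unit I_homog I_saturated X_dim0 supp_X supp_x0.
Let x0_div := gr_x0_div I_homog I_saturated X_dim0 supp_X supp_x0 r_reg.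

Lemma sigma_lin : lin_to (@L0 K n I) sigma.
Proof.
have [[N [d [psi [hpsi sE]]]] _ _] := sigma_trace; split.
- move=> x; rewrite sE; apply: (L0_sum I_homog I_saturated X_dim0 supp_X supp_x0) => l.
  by have [[h _ _] _] := hpsi l; exact: h.
- move=> x y; rewrite !sE -big_split; apply: eq_bigr => l _.
  by have [[_ h _] _] := hpsi l; exact: h.
- move=> b x hb; rewrite !sE mulr_sumr; apply: eq_bigr => l _.
  by have [[_ _ h] _] := hpsi l; exact: h.
Qed.

Lemma sigmaD x y : sigma (x + y) = sigma x + sigma y.
Proof. by have [_ h _] := sigma_lin. Qed.

Lemma sigmaZ b x : L0 b -> sigma (b * x) = b * sigma x.
Proof. by have [_ _ h] := sigma_lin; exact: h. Qed.

Lemma sigma0 : sigma 0 = 0.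
Proof. by have := sigmaZ 0 (L0_0 I); rewrite !mul0r. Qed.

Lemma sigma_sum (T : Type) (l : seq T) (F : T -> Q) :
  sigma (\sum_(i <- l) F i) = \sum_(i <- l) sigma (F i).
Proof. exact: (big_morph sigma sigmaD sigma0). Qed.

Lemma sigma_x0 m q : sigma (iota x0 ^+ m * q) = iota x0 ^+ m * sigma q.
Proof. by apply: sigmaZ; exact: L0_x0X. Qed.

Lemma sigma_homog (e : nat) w : gr e%:Z w ->
  exists c, sigma (iota w) = iota (const c * x0 ^+ e).
Proof.
move=> hw; have [_ hom _] := sigma_trace; have [L0s _ _] := sigma_lin.
apply: (L0_homog I_homog I_saturated X_dim0 supp_X supp_x0 r_reg); last exact: L0s.
rewrite -[e%:Z]addr0; apply: hom.
exact: (to_hquot_gr I_homog I_saturated X_dim0 supp_X supp_x0 hw).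
Qed.

(** Homogeneous parts are defined on [R] and not on Q^h(R); this allows degrees to be compared after
    applying [sigma]. *)
Lemma sigma_homog_part w : exists v, sigma (iota w) = iota v /\
  forall d, sigma (iota (homog_part d w)) = iota (homog_part d v).
Proof.
have /choice[c hc] d := sigma_homog (homog_part_gr d w).
have [N hN] := homog_part_decomp I_homog w.
have hg d : gr d%:Z (const (c d) * x0 ^+ d).
  by have := coord_grM (coord_gr_const I (c d)) (coord_gr_x0X I d); rewrite add0r.
exists (\sum_(i < N) const (c i) * x0 ^+ i); split.
  rewrite {1}(hN N (leqnn N)) !to_hquot_sum sigma_sum.
  by apply: eq_bigr => i _; exact: hc.
move=> d; rewrite homog_part_sum //.
have [dN|Nd] := ltnP d N.
  rewrite (bigD1 (Ordinal dN)) //= big1 ?addr0.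
    by rewrite (homog_part_id I_homog (hg d)) hc.
  move=> i ne; apply: (homog_part_ne I_homog (hg i)) => e.
  by case/eqP: ne; apply: val_inj.
rewrite big1 => [|i _]; last by apply: (homog_part_ne I_homog (hg i)); have := ltn_ord i; lia.
suff -> : homog_part d w = 0 by rewrite to_hquot0 sigma0.
rewrite (hN N (leqnn N)) homog_part_sum // big1 // => i _.
by apply: (homog_part_ne I_homog (homog_part_gr i w)); have := ltn_ord i; lia.
Qed.

(** Vanishing on u R_r spreads to all of u Q^h(R): forms of higher degree are [x0]-multiples of R_r,
    and those of lower degree enter R_r after multiplication by a power of the unit [x0]. Uniqueness
    in [trace_map], for the zero map, then gives [u = 0]. *)
Lemma sigma_nondegenerate u :
  (forall b, gr r%:Z b -> sigma (iota (u * b)) = 0) -> u = 0.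
Proof.
move=> h; have hh (i : nat) f : gr i%:Z f -> sigma (iota (u * f)) = 0.
  move=> hf; have [ri|ir] := leqP r i.
    move: hf; rewrite -(subnK ri) => /x0_div[b hb ->].
    by rewrite mulrCA to_hquotM to_hquotX sigma_x0 h // mulr0.
  have hb : gr r%:Z (x0 ^+ (r - i) * f).
    rewrite -[in r%:Z](subnK (ltnW ir)) PoszD.
    by apply: coord_grM => //; exact: coord_gr_x0X.
  apply: (mulrI (x0X_unit (r - i))).
  by rewrite mulr0 -sigma_x0 -to_hquotX -to_hquotM mulrCA h.
have su q : sigma (iota u * q) = 0.
  have [m [f qf]] := hquot_elim I_homog I_saturated X_dim0 supp_X supp_x0 r_reg q.
  apply: (mulrI (x0X_unit m)); rewrite mulr0 -sigma_x0 mulrC -mulrA qf -to_hquotM.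
  have [N /(_ N (leqnn N)) ->] := homog_part_decomp I_homog f.
  rewrite mulr_sumr to_hquot_sum sigma_sum big1 // => i _.
  exact: hh (homog_part_gr i f).
have [_ _ uniq] := sigma_trace.
have [|g [_ gU]] := uniq (fun _ => 0).
  exists 0%N, (fun _ => 0), (fun _ _ => 0); split=> [[]//|x].
  by rewrite big_ord0.
apply: (@to_hquot_inj K n I); rewrite to_hquot0 -(gU (iota u)) ?(gU 0) //.
by move=> x; rewrite mul0r sigma0.
Qed.

(** The exponent is -1 when [r] is 0, so x0^(r-1) is always handled together with one more factor
    [x0]. *)
Lemma x0_exprz_pred : iota x0 ^ (r%:Z - 1) * iota x0 = iota x0 ^+ r.
Proof.
rewrite -[X in _ * X]expr1z -exprzDr; last exact: x0_unit.
by rewrite subrK.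
Qed.

Section Subscheme.
Variable J : R -> Prop.
Hypothesis J_subscheme : is_subscheme J.

Let J_x0 N x : J (x0 ^+ N * x) -> J x.
Proof.
have [idJ homJ satJ] := J_subscheme.
apply: (saturated_x0 I_homog X_dim0 supp_X supp_x0 idJ) => //.
exact/(homog_idealP I_homog idJ).
Qed.

Let JM a x : J x -> J (a * x).
Proof. by have [[_ _ h] _ _] := J_subscheme; exact: h. Qed.

Lemma different_of_divisible :
  (forall f, J f -> gr r%:Z f -> exists h, f = x0 * h) ->
  forall f, J f -> gr r%:Z f ->
  dedekind_different sigma (iota x0 ^ (r%:Z - 1) * iota f).
Proof.
move=> Jdiv f Jf hf g [phi [_ phiE]].
have {}phiE b : sigma (g * iota b) = iota (phi b).
  by have := phiE b 1; rewrite !mulr1; apply; have := L0_x0X I 0.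
have [m [u0 gu0]] := hquot_elim I_homog I_saturated X_dim0 supp_X supp_x0 r_reg g.
(* The extra factor makes the denominator x0^(m+r), so the part of [u] of degree [m] is the
   component of [g] of degree -r. *)
pose u := u0 * x0 ^+ r.
have gu : g * iota x0 ^+ (m + r) = iota u.
  by rewrite exprD mulrA gu0 /u to_hquotM to_hquotX.
(* Since sigma (g b) = phi b lies in R, sigma (u b) = x0^(m+r) phi b has no part of degree below m +
   r. Nondegeneracy then kills the low parts of [u]. *)
have ulow d : (d < m)%N -> homog_part d u = 0.
  move=> dm; apply: sigma_nondegenerate => b hb.
  have [v [sv svd]] := sigma_homog_part (b * u).
  rewrite mulrC -(homog_part_mul I_homog d u hb) svd.
  have -> : v = x0 ^+ (m + r) * phi b.
    apply: (@to_hquot_inj K n I); rewrite -sv to_hquotM -gu to_hquotM to_hquotX -phiE.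
    by rewrite -sigma_x0; congr (sigma _); ring.
  by rewrite (homog_part_mul_lt I_homog _ (coord_gr_x0X I (m + r))) ?to_hquot0 //; lia.
have [h fu] : exists h, f * u = x0 ^+ m.+1 * h.
  have [N /(_ N (leqnn N)) ->] := homog_part_decomp I_homog u.
  rewrite mulr_sumr; apply: (big_ind (fun y => exists h, y = x0 ^+ m.+1 * h)).
  - by exists 0; rewrite mulr0.
  - by move=> _ _ [a ->] [b ->]; exists (a + b); rewrite mulrDr.
  move=> i _; have [im|mi] := ltnP i m; first by exists 0; rewrite ulow // !mulr0.
  have hfu : gr (i + r)%N%:Z (f * homog_part i u).
    by rewrite addnC PoszD; apply: coord_grM => //; exact: homog_part_gr.
  have [h hh fuE] := x0_div hfu.
  (* Only for [i = m] is one factor [x0] missing. There [h] belongs to J_r, by saturation, and the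
     hypothesis on [J] supplies it. *)
  move: mi; rewrite leq_eqVlt => /orP[/eqP mi|mi].
    have [|h' hE] := Jdiv h _ hh.
      by apply: (@J_x0 i); rewrite -fuE mulrC; exact: JM.
    by exists h'; rewrite fuE hE -mi exprSr mulrA.
  exists (x0 ^+ (i - m.+1) * h).
  by rewrite fuE mulrA -exprD subnKC.
exists h; apply: (mulIr (x0X_unit (m + r).+1)).
rewrite exprS; transitivity
  (iota x0 ^ (r%:Z - 1) * iota x0 * (iota f * (g * iota x0 ^+ (m + r)))).
  by ring.
rewrite x0_exprz_pred gu -to_hquotM fu to_hquotM to_hquotX !exprS exprD.
by ring.
Qed.

(** A form [f] of J_r outside x0 R is separated from x0 R by a functional on R_r, and nondegeneracy
    turns the functional into an element [g] of the complementary module. Minimality of N takes the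
    form that a factor which does not kill [f] has a unit as germ at [p j]. *)
Lemma divisible_of_different j (t : local_ring (p j)) :
  (forall k, k != j -> forall a, ideal_at (p := p k) J a -> a = 0) ->
  (forall a, ideal_at J a -> principal t a) -> socle t ->
  (forall f, J f -> gr r%:Z f ->
     dedekind_different sigma (iota x0 ^ (r%:Z - 1) * iota f)) ->
  forall f, J f -> gr r%:Z f -> exists h, f = x0 * h.
Proof.
move=> Jk Jj tsoc Jdiff f Jf hf; apply: contrapT => fdiv.
(* This [W] is x0^r V_(r-1); the orthogonal space of the overview appears only through its element
   [w], up to a power of [x0]. *)
pose W y := gr r%:Z y /\ exists h, y = x0 * h.
have hV := coord_gr_subspace I r%:Z.
have hW : is_subspace const W.
  split=> [|c x y [hx [a xa]] [hy [b yb]]].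
    by split; [exact: coord_gr0 | exists 0; rewrite mulr0].
  by split; [exact: (proj2 hV) | exists (const c * a + b); rewrite xa yb; ring].
have [m' [b' hb']] := coord_gr_basis r hW.
have [|l [llin lW lf]] := quot_basis_functional hV hW hb' hf.
  by move=> [_].
have l_sum (c : 'I_D -> K) (b : 'I_D -> R) : (forall i, gr r%:Z (b i)) ->
    l (\sum_i const (c i) * b i) = \sum_i c i * l (b i).
  move=> hb; suff [] : gr r%:Z (\sum_i const (c i) * b i) /\
    l (\sum_i const (c i) * b i) = \sum_i c i * l (b i) by [].
  elim/big_rec2: _ => [|i y x _ [hx <-]].
    split; first exact: coord_gr0.
    by apply: lW; [exact: coord_gr0 | case: hW].
  by split; [exact: (proj2 hV) | exact: llin].
have [b [Vb bspan bfree]] := gr_basis r_reg (leqnn r).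
have bbgr i k : gr (r + r)%N%:Z (b i * b k) by rewrite PoszD; exact: coord_grM.
have /choice[G' hG'] i : exists c : 'I_D -> K, forall k,
    sigma (iota (b i * b k)) = iota (const (c k) * x0 ^+ (r + r)).
  by have /choice[c hc] k := sigma_homog (bbgr i k); exists c.
pose G := \matrix_(i, k) G' i k.
have pairing (c d : 'I_D -> K) :
    sigma (iota ((\sum_i const (c i) * b i) * (\sum_k const (d k) * b k))) =
    iota (const (\sum_i c i * (\sum_k G i k * d k)) * x0 ^+ (r + r)).
  have -> : (\sum_i const (c i) * b i) * (\sum_k const (d k) * b k) =
     \sum_i \sum_k const (c i * d k) * (b i * b k).
    rewrite mulr_suml; apply: eq_bigr => i _; rewrite mulr_sumr.
    by apply: eq_bigr => k _; rewrite rmorphM /=; ring.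
  rewrite to_hquot_sum sigma_sum rmorph_sum mulr_suml to_hquot_sum.
  apply: eq_bigr => i _; rewrite to_hquot_sum sigma_sum.
  rewrite rmorphM /= rmorph_sum mulr_sumr mulr_suml to_hquot_sum.
  apply: eq_bigr => k _; rewrite to_hquotM sigmaZ; last exact: L0_const.
  by rewrite hG' -to_hquotM mxE; congr iota; rewrite !rmorphM /=; ring.
(* A vector in the left kernel of the Gram matrix gives a form of degree [r] that pairs to 0 with
   all of R_r. *)
have Gunit : G \in unitmx.
  rewrite -row_free_unit; apply: inj_row_free => c cG0.
  apply/rowP => i; rewrite mxE; apply: (bfree (c 0)).
  apply: sigma_nondegenerate => y /bspan[d /eqP]; rewrite subr_eq0 => /eqP ->.
  rewrite pairing.
  have -> : \sum_i c 0 i * (\sum_k G i k * d k) = (c *m G *m (\col_k d k)) 0 0.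
    rewrite -mulmxA mxE; apply: eq_bigr => i' _; congr (_ * _).
    by rewrite mxE; apply: eq_bigr => k _; congr (_ * _); rewrite mxE.
  by rewrite cG0 mul0mx mxE rmorph0 mul0r to_hquot0.
(* Solving with the Gram matrix represents the functional [l] as the pairing with [w]. *)
pose y := invmx G *m \col_i l (b i).
pose w := \sum_k const (y k 0) * b k.
have wgr : gr r%:Z w by apply: subspace_lin => //; exact: coord_gr_subspace.
have sw h : gr r%:Z h -> sigma (iota (h * w)) = iota (const (l h) * x0 ^+ (r + r)).
  move=> /bspan[c /eqP]; rewrite subr_eq0 => /eqP ->; rewrite pairing l_sum //.
  congr (iota (const _ * _)); apply: eq_bigr => i _; congr (_ * _).
  have : (G *m y) i 0 = l (b i) by rewrite mulKVmx // mxE.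
  by rewrite mxE.
(* As [w] has degree [r], this [g] has degree -r, and h |-> sigma (g h) is [l] itself on R_r. *)
pose g := iota w / iota x0 ^+ (r + r).
have sg h : sigma (g * iota h) = sigma (iota (h * w)) / iota x0 ^+ (r + r).
  rewrite /g mulrAC mulrC sigmaZ; last exact: L0_x0V.
  by rewrite -to_hquotM mulrC [w * h]mulrC.
have sgr h : gr r%:Z h -> sigma (g * iota h) = iota (const (l h)).
  by move=> hh; rewrite sg sw // to_hquotM to_hquotX mulrK.
have sgi (i : nat) h : gr i%:Z h -> exists c,
    sigma (g * iota h) = iota (const c * x0 ^+ (i - r)) /\ ((i < r)%N -> c = 0).
  move=> hh; have [ri|ir] := leqP r i.
    move: hh; rewrite -[in i%:Z](subnK ri) => /x0_div[z hz ->].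
    exists (l z); split=> //.
    rewrite to_hquotM to_hquotX mulrCA sigma_x0 sgr //.
    by rewrite -to_hquotX -to_hquotM mulrC.
  (* For [i < r] the multiple [x0 ^+ (r - i) * h] lies in [W], where [l] vanishes. This keeps
     negative powers of [x0] out of the values of sigma (g h). *)
  exists 0; split=> //; rewrite rmorph0 mul0r to_hquot0.
  have e : (r - i = (r - i).-1.+1)%N by lia.
  have hz : gr r%:Z (x0 ^+ (r - i) * h).
    rewrite -[in r%:Z](subnK (ltnW ir)) PoszD.
    by apply: coord_grM => //; exact: coord_gr_x0X.
  apply: (mulrI (x0X_unit (r - i))).
  rewrite mulr0 -sigma_x0 mulrCA -to_hquotX -to_hquotM sgr // lW //.
    by rewrite rmorph0 to_hquot0.
  by split=> //; exists (x0 ^+ (r - i).-1 * h); rewrite mulrA -exprS -e.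
have Kx0D (u v : R) : Kx0 u -> Kx0 v -> Kx0 (u + v).
  by move=> [h ->] [h' ->]; exists (h + h'); rewrite rmorphD hornerD.
have Kx0M c k : Kx0 (const c * x0 ^+ k).
  exists (c%:P * 'X^k); rewrite rmorphM /= map_polyC map_polyXn.
  by rewrite hornerM hornerC hornerXn.
have /choice[phi hphi] h : exists v, Kx0 v /\ sigma (g * iota h) = iota v.
  have [N /(_ N (leqnn N)) ->] := homog_part_decomp I_homog h.
  apply: (big_ind (fun h => exists v, Kx0 v /\ sigma (g * iota h) = iota v)).
  - exists 0; split; first by have := Kx0M 0 0%N; rewrite rmorph0 mul0r.
    by rewrite to_hquot0 mulr0 sigma0.
  - move=> h1 h2 [v1 [k1 e1]] [v2 [k2 e2]]; exists (v1 + v2); split; first exact: Kx0D.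
    by rewrite !to_hquotD mulrDr sigmaD e1 e2.
  - move=> i _; have [c [e _]] := sgi i _ (homog_part_gr i h).
    by exists (const c * x0 ^+ (i - r)).
have phiE h : iota (phi h) = sigma (g * iota h) by have [] := hphi h.
have gC : dedekind_complementary sigma g.
  exists phi; split; last first.
    move=> h q hq; rewrite phiE [RHS]mulrC -sigmaZ //; congr (sigma _); ring.
  exists 1%N, (fun _ => - r%:Z), (fun _ => phi); split; last by move=> h; rewrite big_ord1.
  move=> _; split; first split.
  - by move=> h; have [] := hphi h.
  - move=> h1 h2; apply: (@to_hquot_inj K n I).
    by rewrite to_hquotD !phiE to_hquotD mulrDr sigmaD.
  - move=> a h [P aP]; apply: (@to_hquot_inj K n I).
    rewrite to_hquotM !phiE to_hquotM mulrCA; apply: sigmaZ; rewrite aP.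
    by have := L0_poly I P 0; rewrite divr1.
  - move=> [i|i] h hh; last first.
      have -> : phi h = 0; last exact: coord_gr0.
      apply: (@to_hquot_inj K n I).
      by rewrite phiE (coord_gr_neg hh) to_hquot0 mulr0 sigma0.
    have [c [e c0]] := sgi i h hh.
    have -> : phi h = const c * x0 ^+ (i - r) by apply: (@to_hquot_inj K n I); rewrite phiE.
    have [ir|ri] := ltnP i r; first by rewrite c0 // rmorph0 mul0r; exact: coord_gr0.
    have := coord_grM (coord_gr_const I c) (coord_gr_x0X I (i - r)).
    by rewrite add0r (_ : (i - r)%N%:Z = i%:Z - r%:Z) //; lia.
have fw0 : f * w <> 0.
  move=> fw; have := sw f hf; rewrite fw to_hquot0 sigma0 -(to_hquot0 I).
  move=> /to_hquot_inj/esym; rewrite mulrC.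
  move=> /(x0_nzd I_homog I_saturated X_dim0 supp_X supp_x0) e.
  have /negP := oner_neq0 R; apply; apply/eqP.
  by rewrite -(rmorph1 const) -(@mulVf _ (l f)) ?rmorphM /= ?e ?mulr0 //; apply/eqP.
have fk k : k != j -> germ (p k) r f = 0.
  by move=> kj; apply: (Jk k kj); exact: ideal_at_germ.
have fwgr : gr (r + r)%N%:Z (f * w) by rewrite PoszD; exact: coord_grM.
have [a fj] : principal t (germ (p j) r f) by apply: Jj; exact: ideal_at_germ.
(* A nonunit germ of [w] would kill the socle element [t], hence the germ of [f * w] at [p j]; at
   the other points [f] has germ 0 already. *)
have [z0 z0E] : exists z0, z0 * germ (p j) r w = 1.
  apply: contrapT => nu; apply: fw0.
  apply: (germ_inj I_homog I_saturated X_dim0 supp_X supp_x0 fwgr) => k.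
  have [->|kj] := eqVneq k j; last by rewrite -germM // fk // mul0r.
  by rewrite -germM // fj -mulrA [t * _]mulrC (tsoc _ nu) mulr0.
have [z hz z0z] := germ_surj I_homog I_saturated X_dim0 supp_X supp_x0 r_reg z0.
have zgr : gr (r + r)%N%:Z (z * f) by rewrite PoszD; exact: coord_grM.
have [f' hf' zf] := x0_div zgr.
(* So f' w = x0^r f, that is, [f'] divides [f] by [w] inside N: [z] inverts [w] at [p j], and both
   sides have germ 0 elsewhere. *)
have zfw : x0 ^+ r * f' * w = x0 ^+ (r + r) * f.
  rewrite -zf; have g3 : gr (r + r + r)%N%:Z (z * f * w) by rewrite PoszD; exact: coord_grM.
  have g3' : gr (r + r + r)%N%:Z (x0 ^+ (r + r) * f).
    by rewrite PoszD; apply: coord_grM => //; exact: coord_gr_x0X.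
  apply: (germ_inj2 I_homog I_saturated X_dim0 supp_X supp_x0 g3 g3') => k.
  rewrite (germ_x0 (supp_x0 k) (r + r) hf) -(germM (supp_x0 k) zgr wgr).
  rewrite -(germM (supp_x0 k) hz hf).
  have [->|kj] := eqVneq k j; last by rewrite fk // mulr0 mul0r.
  by rewrite -z0z mulrAC z0E mul1r.
have Jf' : J f' by apply: (@J_x0 r); rewrite -zf; exact: JM.
(* The product x0^(r-1) f' g equals f / x0, so its lying in R contradicts the choice of [f]. *)
have [h' hE] := Jdiff f' Jf' hf' g gC.
apply: fdiv; exists h'; apply: (@to_hquot_inj K n I).
apply: (mulIr (x0X_unit (r + r + r))); rewrite to_hquotM -hE /g.
have wK : iota w / iota x0 ^+ (r + r) * iota x0 ^+ (r + r) = iota w by rewrite divrK.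
transitivity (iota x0 ^+ r * iota (x0 ^+ r * f' * w)).
  by rewrite zfw to_hquotM to_hquotX !exprD; ring.
transitivity (iota x0 ^ (r%:Z - 1) * iota x0 * iota f' *
    (iota w / iota x0 ^+ (r + r) * iota x0 ^+ (r + r)) * iota x0 ^+ r).
  by rewrite wK x0_exprz_pred !to_hquotM !to_hquotX; ring.
by rewrite [iota x0 ^+ (r + r + r)]exprD; ring.
Qed.

End Subscheme.

End Different.

(** * The Cayley-Bacharach property *)

(** R vanishes in negative degrees, so a negative index would make the constant value 0 and force 1
    = 0 in R_0. *)
Lemma regularity_index_ge0 (K : fieldType) (n : nat) (I : idealr {mpoly K[n.+1]})
    (s : nat) (p : 'I_s -> prime_idealr {ideal_quot I}) (r : int) :
  regularity_index p r -> exists r' : nat, r = r'%:Z.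
Proof.
case: r => [r|r] [reg _]; first by exists r.
have hf0 : hilbert_function I (Negz r) = 0%N.
  apply: (@quot_basis_dim _ _ (@coord_const K n I) _ _ 0 (fun _ => 0)).
    exact: (zero_subspace (@coord_const K n I)).
  split=> [i|x /coord_gr_neg ->|c _ i]; [exact: coord_gr0 | | by have := ltn_ord i].
  by exists (fun _ => 0); rewrite big_ord0 subr0.
have reg0 (i : int) : (0%N%:Z <= i)%R -> hilbert_function I i = 0%N.
  move=> i0; rewrite -hf0.
  have regE l : (Negz r <= l)%R -> hilbert_function I l = degree p := reg l.
  by rewrite !regE //; lia.
have [b [_ bspan _]] := gr_basis reg0 (leqnn 0).
have [c] := bspan 1 (coord_gr1 I); rewrite big_ord0 subr0 => /eqP.
by rewrite oner_eq0.
Qed.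

Section CayleyBacharach.
Variables (K : fieldType) (n : nat) (I : idealr {mpoly K[n.+1]}).
Local Notation R := {ideal_quot I}.
Local Notation gr := (@coord_gr K n I).
Local Notation x0 := (x0 I).
Hypothesis I_homog : homog_ideal (@poly_gr K n) (fun f => f \in I).
Hypothesis I_saturated : saturated (@poly_gr K n) (fun f => f \in I).
Variables (s : nat) (p : 'I_s -> prime_idealr R).
Hypothesis X_dim0 : proj_dim0 gr.
Hypothesis supp_X : enumerates_closed_points gr p.
Hypothesis supp_x0 : forall j, x0 \notin p j.
Variables (r : nat) (D : nat).
Hypothesis r_reg : forall i : int, (r%:Z <= i)%R -> hilbert_function I i = D.
Hypothesis X_local : forall j, is_local (local_ring (p j)).
Hypothesis X_noetherian : forall j, noetherian (local_ring (p j)).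

(** In the notation of the overview: N is contained in V_(r-1). *)
Definition divisible_at_r (J : R -> Prop) : Prop :=
  forall f, J f -> gr r%:Z f -> exists h, f = x0 * h.

Lemma lifted_in_subscheme j J (i : nat) (a : local_ring (p j)) h :
  is_subscheme J -> ideal_at J a -> gr i%:Z h -> germ (p j) i h = a ->
  (forall k, k != j -> germ (p k) i h = 0) -> J h.
Proof.
move=> subJ Ja hh hj hk; have [idJ _ _] := subJ.
apply: (subscheme_mem I_homog X_dim0 supp_X supp_x0 subJ hh) => k.
have [->|kj] := eqVneq k j; first by rewrite hj.
by rewrite hk //; case: (ideal_at_ideal (supp_x0 k) idJ).
Qed.

(** The lift of [a] to degree [r] lies in [J], and dividing it by [x0] lowers the degree by one. For
    [r = 0] a form of degree 0 divisible by [x0] is 0, hence the case distinction. *)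
Lemma divisible_lifted j J (a : local_ring (p j)) :
  is_subscheme J -> ideal_at J a -> divisible_at_r J ->
  if r is r'.+1 then lifted r' a else a = 0.
Proof.
move=> subJ Ja divJ.
have [h [hh hj hk]] := lifted_r I_homog I_saturated X_dim0 supp_X supp_x0 r_reg a.
have [h' hE] := divJ h (lifted_in_subscheme subJ Ja hh hj hk) hh.
case: r hh hj hk => [|r'] hh hj hk.
  rewrite -hj -(homog_part_id I_homog hh) hE (homog_part_mul_lt I_homog h' (coord_gr_x0 I)) //.
  by rewrite germ0.
have hx : h = x0 ^+ 1 * homog_part r' h'.
  by rewrite -(homog_part_mul I_homog r' h' (coord_gr_x0X I 1)) -hE homog_part_id.
exists (homog_part r' h'); split=> [||k kj]; first exact: homog_part_gr.
- by rewrite -hj hx (germ_x0 (supp_x0 j) 1 (homog_part_gr r' h')).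
- by rewrite -(hk k kj) hx (germ_x0 (supp_x0 k) 1 (homog_part_gr r' h')).
Qed.

Lemma mu_sub_exists j J : maximal_subscheme p j J -> exists m, @is_mu_sub K n I s p j J m.
Proof.
move=> maxJ.
have [t [t0 tsoc tJ]] := maximal_subscheme_socle I_homog I_saturated X_dim0 supp_X
  supp_x0 r_reg X_local X_noetherian maxJ.
have [e he] := residue_basis I_homog I_saturated X_dim0 supp_X supp_x0 r_reg X_local j.
by exists (\max_k mu (e k * t)%R), t, (residue_deg (p j)), e; split.
Qed.

(** As [t] is killed by the maximal ideal, the [e k * t] span [principal t] over K, so all its
    elements lift to degree r - 1 as soon as these do. In particular the condition [m < r] does not
    depend on the choice of [t] and [e]. *)
Lemma divisible_mu_sub j J m : maximal_subscheme p j J -> @is_mu_sub K n I s p j J m ->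
  divisible_at_r J <-> (m < r)%N.
Proof.
move=> [[subJ Jk] _] [t [N [e [[t0 tsoc] tJ he ->]]]].
have [idJ _ _] := subJ.
have Jt a : ideal_at (p := p j) J (a * t) by apply/tJ; exists a.
split=> [divJ|lt_r f Jf hf].
  case: (posnP r) => [r0|r0].
    by have := divisible_lifted subJ (Jt 1) divJ; rewrite r0 mul1r => /t0.
  rewrite -(prednK r0) ltnS; apply/bigmax_leqP => k _.
  apply/(mu_le I_homog I_saturated X_dim0 supp_X supp_x0 r_reg).
  by have := divisible_lifted subJ (Jt (e k)) divJ; rewrite -{1}(prednK r0).
have r0 : (0 < r)%N by case: (r) lt_r.
have /choice[h hh] k : lifted r.-1 (e k * t).
  apply/(mu_le I_homog I_saturated X_dim0 supp_X supp_x0 r_reg).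
  rewrite -ltnS prednK //; apply: leq_ltn_trans lt_r.
  exact: (leq_bigmax k).
have [a fa] : principal t (germ (p j) r f) by apply/tJ; exact: ideal_at_germ.
have [_ espan _] := he; have [c hc] := espan a Logic.I.
have hgr : gr r.-1%:Z (\sum_k coord_const I (c k) * h k).
  by apply: subspace_lin => [|k]; [exact: coord_gr_subspace | have [] := hh k].
exists (\sum_k coord_const I (c k) * h k); rewrite -[x0 in RHS]expr1.
have xhgr : gr r%:Z (x0 ^+ 1 * \sum_k coord_const I (c k) * h k).
  by rewrite -{1}(prednK r0) -add1n PoszD; apply: coord_grM => //; exact: coord_gr_x0X.
apply: (germ_inj2 I_homog I_saturated X_dim0 supp_X supp_x0 hf xhgr) => k.
rewrite -[in RHS](prednK r0) -add1n (germ_x0 (supp_x0 k) 1 hgr) germ_sum //;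
  last by move=> l; have [] := hh l.
have [->|kj] := eqVneq k j; last first.
  rewrite (Jk k kj _ (ideal_at_germ (supp_x0 k) hf Jf)) big1 // => l _.
  by have [_ _ ->] := hh l; rewrite ?mulr0.
have -> : \sum_l local_const (p j) (c l) * germ (p j) r.-1 (h l) =
    (\sum_l local_const (p j) (c l) * e l) * t.
  by rewrite mulr_suml; apply: eq_bigr => l _; have [_ -> _] := hh l; rewrite mulrA.
by rewrite fa; apply/eqP; rewrite -subr_eq0 -mulrBl; apply/eqP; exact: tsoc hc.
Qed.

(** [point_degree] is a minimum with default 0, so bounding it below by [r] requires a maximal
    subscheme at each point, which a socle element of the local ring provides. *)
Lemma cayley_bacharach_divisible :
  cayley_bacharach p r%:Z <->
  forall j J, maximal_subscheme p j J -> ~ divisible_at_r J.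
Proof.
rewrite /cayley_bacharach /CBP subrK; split=> [cb j J maxJ divJ|ndiv j].
  have [m hm] := mu_sub_exists maxJ; have := cb j.
  move/(divisible_mu_sub maxJ hm): divJ => lt_m; rewrite lez_nat leqNgt => /negP[].
  apply: leq_ltn_trans lt_m.
  have [_ //] := @natmin_spec
    (fun m => exists2 J, maximal_subscheme p j J & @is_mu_sub K n I s p j J m)
    m (ex_intro2 _ _ J maxJ hm).
have [J maxJ] := maximal_subscheme_exists I_homog I_saturated X_dim0 supp_X
  supp_x0 r_reg X_local X_noetherian j.
have [m hm] := mu_sub_exists maxJ.
rewrite lez_nat; apply: (@natmin_lb _ m); first by exists J.
move=> l [J' maxJ' hl]; rewrite leqNgt; apply/negP.
by move/(divisible_mu_sub maxJ' hl); exact: ndiv maxJ'.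
Qed.

End CayleyBacharach.

Theorem theorem4p5 (K : fieldType) (n : nat) (I : idealr {mpoly K[n.+1]})
    (I_homog : homog_ideal (@poly_gr K n) (fun f => f \in I))
    (I_saturated : saturated (@poly_gr K n) (fun f => f \in I))
    (X_dim0 : proj_dim0 (@coord_gr K n I))
    (s : nat) (p : 'I_s -> prime_idealr {ideal_quot I})
    (supp_X : enumerates_closed_points (@coord_gr K n I) p)
    (supp_x0 : forall j, x0 I \notin p j)
    (X_gorenstein : forall j, gorenstein_local (local_ring (p j)))
    (r : int) (r_reg : regularity_index p r)
    (sigma : hquot I -> hquot I) (sigma_trace : trace_map sigma) :
  cayley_bacharach p r <->
  forall (j : 'I_s) (J : {ideal_quot I} -> Prop), maximal_subscheme p j J ->
    ~ (forall f, J f -> coord_gr r f ->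
         dedekind_different sigma (to_hquot (x0 I) ^ (r - 1) * to_hquot f) /\
         hquot_gr (2%:Z * r - 1) (to_hquot (x0 I) ^ (r - 1) * to_hquot f)).
Proof.
have [r' e] := regularity_index_ge0 r_reg; subst r; case: r_reg => reg _.
have X_noeth j : noetherian (local_ring (p j)) by case: (X_gorenstein j).
have X_local j : is_local (local_ring (p j)) by case: (X_gorenstein j).
(* The degree condition holds for every form of degree r, so only membership in the different
   remains. Multiplying by one [x0] ([m := 1]) absorbs the exponent r - 1, which may be -1. *)
have degE f : coord_gr r'%:Z f ->
    hquot_gr (2%:Z * r'%:Z - 1) (to_hquot (x0 I) ^ (r'%:Z - 1) * to_hquot f).
  move=> hf; apply: (hquot_gr_intro I_homog I_saturated X_dim0 supp_X supp_x0
    (m := 1) (f := x0 I ^+ r' * f)).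
    have -> : 2%:Z * r'%:Z - 1 + 1%N%:Z = r'%:Z + r'%:Z by lia.
    by apply: coord_grM => //; exact: coord_gr_x0X.
  rewrite expr1 mulrAC (x0_exprz_pred I_homog I_saturated X_dim0 supp_X supp_x0).
  by rewrite to_hquotM to_hquotX.
have main j J : maximal_subscheme p j J ->
    (forall f, J f -> coord_gr r'%:Z f ->
       dedekind_different sigma (to_hquot (x0 I) ^ (r'%:Z - 1) * to_hquot f)) <->
    divisible_at_r r' J.
  move=> maxJ; have [[subJ Jk] _] := maxJ; split=> [diffJ|divJ].
    have [t [_ tsoc tJ]] := maximal_subscheme_socle I_homog I_saturated X_dim0 supp_X
      supp_x0 reg X_local X_noeth maxJ.
    apply: (divisible_of_different I_homog I_saturated X_dim0 supp_X supp_x0 reg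
      sigma_trace subJ Jk _ tsoc diffJ).
    by move=> a /tJ.
  exact: (different_of_divisible I_homog I_saturated X_dim0 supp_X supp_x0 reg
    sigma_trace subJ divJ).
apply: (iff_trans (cayley_bacharach_divisible I_homog I_saturated X_dim0 supp_X
  supp_x0 reg X_local X_noeth)).
split=> h j J maxJ hJ; apply: (h j J maxJ).
  by apply/(main j J maxJ) => f Jf hf; have [] := hJ f Jf hf.
by move=> f Jf hf; split; [move/(main j J maxJ): hJ; apply | exact: degE].
Qed.
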